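(* Let $T$ be a bilateral weighted shift acting on $\ell_p(\mathbb{Z})$. If $1\le p<2$ and $T$ is weakly hypercyclic, then $T$ is hypercyclic. If $1\le p\le 2$ and $T$ is weakly supercyclic, then $T$ is supercyclic.
   Context: All spaces are complex. Given a bounded sequence $\{w_n\}_{n\in\mathbb{Z}}$ in $\mathbb{C}\setminus\{0\}$ (the weight sequence), the bilateral weighted shift $T$ on $\ell_p(\mathbb{Z})$ is the bounded linear operator defined on the canonical basis $\{e_n\}_{n\in\mathbb{Z}}$ by $Te_n=w_ne_{n-1}$. For a bounded linear operator $T$ on a Banach space $\mathcal{B}$ and $x\in\mathcal{B}$ put $O(T,x)=\{T^nx:n=0,1,2,\dots\}$ and $O_{\rm pr}(T,x)=\{\lambda T^nx:n=0,1,2,\dots,\ \lambda\in\mathbb{C}\}$. $T$ is hypercyclic (weakly hypercyclic) if $O(T,x)$ is norm dense (weakly dense) in $\mathcal{B}$ for some $x$; $T$ is supercyclic (weakly supercyclic) if $O_{\rm pr}(T,x)$ is norm dense (weakly dense) in $\mathcal{B}$ for some $x$. *)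

(* Defs.v *)
From HB Require Import structures.
From mathcomp Require Import all_boot all_order all_algebra complex ring.
From mathcomp Require Import all_classical all_reals all_analysis.
Import Order.TTheory GRing.Theory Num.Theory.
Import ComplexField.Normc numFieldNormedType.Exports.

Set Implicit Arguments.
Unset Strict Implicit.
Unset Printing Implicit Defensive.

Local Open Scope classical_set_scope.
Local Open Scope ring_scope.
Local Open Scope complex_scope.

Section Cyclicity.
Variables (K : numFieldType) (V : normedModType K).

(* The weak topology: the coarsest topology on V making every norm-continuous
   linear functional V -> K continuous. *)
Definition weak_topology : topologicalType :=
  sup_topology (fun f : {f : {linear V -> K^o} | continuous f} =>
    Topological.class (initial_topology (sval f))).

Definition weakly_dense (A : set V) := dense (A : set weak_topology).

Variable T : V -> V.

Definition orbit (x : V) : set V := [set y | exists n, y = iter n T x].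

Definition projective_orbit (x : V) : set V :=
  [set y | exists n (l : K), y = l *: iter n T x].

Definition hypercyclic := exists x, dense (orbit x).
Definition weakly_hypercyclic := exists x, weakly_dense (orbit x).
Definition supercyclic := exists x, dense (projective_orbit x).
Definition weakly_supercyclic := exists x, weakly_dense (projective_orbit x).

End Cyclicity.

Section SequenceSpace.
Variables (R : realType) (p : R).
Hypothesis p1 : 1 <= p.

Let p0 : 0 < p. Proof. exact: lt_le_trans p1. Qed.

(* Scalar multiplication on R[i]^o is multiplication in R[i]. *)
Local Notation seqC := (int -> R[i]^o).
Implicit Types x y : seqC.

Let normc_ge0 (z : R[i]) : 0 <= normc z.
Proof. by case: z => ? ?; exact: sqrtr_ge0. Qed.

Definition lp_sum x : \bar R := \esum_(n in [set: int]) (normc (x n) `^ p)%:E.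

(* The unused proof of 1 <= p makes the carrier determine it, so that the
   structures below, which need it, can be inferred. *)
Definition lp_pred of 1 <= p : {pred seqC} :=
  mem [set x | (lp_sum x < +oo)%E].

Local Notation lp_set := (lp_pred p1).

Definition lp_norm x : R := fine (lp_sum x) `^ p^-1.

Lemma lp_setP x : reflect (lp_sum x < +oo)%E (x \in lp_set).
Proof. by apply: (iffP idP); rewrite inE. Qed.

Lemma lp_sum_ge0 x : (0 <= lp_sum x)%E.
Proof. by apply: esum_ge0 => n _; rewrite lee_fin powR_ge0. Qed.

Lemma lp_sumE x : x \in lp_set -> lp_sum x = (lp_norm x `^ p)%:E.
Proof.
move=> /lp_setP xoo; rewrite /lp_norm -powRrM mulVf ?gt_eqF// powRr1.
  by rewrite fineK// ge0_fin_numE// lp_sum_ge0.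
by rewrite fine_ge0// lp_sum_ge0.
Qed.

Lemma lp_norm_le x (a : R) : 0 <= a ->
  (lp_sum x <= (a `^ p)%:E)%E -> x \in lp_set /\ lp_norm x <= a.
Proof.
move=> a0 xa; have xoo : x \in lp_set.
  by apply/lp_setP; rewrite (le_lt_trans xa)// ltry.
split=> //; move: xa; rewrite lp_sumE// lee_fin => xa.
rewrite leNgt; apply/negP => ax; move: xa; apply/negP; rewrite -ltNge.
by rewrite gt0_ltr_powR// ?nnegrE// ?powR_ge0.
Qed.

Let esumZ (c : R) (f : int -> R) : 0 <= c -> (forall n, 0 <= f n) ->
  (\esum_(n in [set: int]) (c * f n)%:E <=
   c%:E * \esum_(n in [set: int]) (f n)%:E)%E.
Proof.
move=> c0 f0; apply: ge_ereal_sup => _ [A [finA _]] <-.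
under eq_fsbigr do rewrite EFinM.
rewrite -ge0_mule_fsumr; last by move=> i; rewrite lee_fin.
rewrite lee_wpmul2l ?lee_fin//; apply: ereal_sup_ubound; exists A => //.
Qed.

Let minkowski_aux x y (a b : R) : 0 < a -> 0 < b ->
  (lp_sum x <= (a `^ p)%:E)%E -> (lp_sum y <= (b `^ p)%:E)%E ->
  (lp_sum (x + y)%R <= ((a + b) `^ p)%:E)%E.
Proof.
move=> a0 b0 xa yb; have ab0 : 0 < a + b by rewrite addr_gt0.
have a0' := ltW a0; have b0' := ltW b0; have ab0' := ltW ab0.
have l0 : 0 <= a / (a + b) by rewrite divr_ge0.
have l1 : a / (a + b) <= 1 by rewrite ler_pdivrMr// mul1r lerDl.
have lE : 1 - a / (a + b) = b / (a + b).
  by field; rewrite gt_eqF.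
pose c := (a + b) `^ p * (a / (a + b)) / a `^ p.
pose d := (a + b) `^ p * (b / (a + b)) / b `^ p.
have c0 : 0 <= c by rewrite /c; apply: divr_ge0; rewrite ?powR_ge0// mulr_ge0 ?powR_ge0.
have d0 : 0 <= d.
  rewrite /d; apply: divr_ge0; rewrite ?powR_ge0//.
  by rewrite mulr_ge0 ?powR_ge0// divr_ge0.
have pw n : normc ((x + y) n) `^ p <=
    c * normc (x n) `^ p + d * normc (y n) `^ p.
  have := @convex_powR R p p1 (Itv01 l0 l1) (normc (x n) / a)
    (normc (y n) / b).
  rewrite !inE/= !in_itv/= !andbT !divr_ge0// => /(_ isT isT).
  rewrite [X in X `^ _ <= _ -> _]convRE convRE/= /unstable.onem lE.
  have -> : a / (a + b) * (normc (x n) / a) + b / (a + b) * (normc (y n) / b) =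
      (normc (x n) + normc (y n)) / (a + b).
    by field; rewrite !gt_eqF.
  move=> cvx.
  have nxy : normc ((x + y) n) `^ p <= (normc (x n) + normc (y n)) `^ p.
    by rewrite ge0_ler_powR ?nnegrE ?addr_ge0 ?(ltW p0)//; exact: le_normcD.
  apply: (le_trans nxy).
  have {1}-> : normc (x n) + normc (y n) =
      (a + b) * ((normc (x n) + normc (y n)) / (a + b)).
    by field; rewrite gt_eqF.
  rewrite powRM ?divr_ge0 ?addr_ge0//.
  apply: (le_trans (ler_wpM2l (powR_ge0 _ _) cvx)).
  have dv (u v : R) : 0 <= u -> 0 < v -> (u / v) `^ p = u `^ p / v `^ p.
    move=> u0 v0; rewrite powRM ?invr_ge0 ?(ltW v0)//; congr (_ * _).
    by rewrite -(powR_inv1 (ltW v0)) -powRrM mulN1r powRN.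
  by rewrite !dv// /c /d le_eqVlt; apply/orP; left; apply/eqP; ring.
apply: (@le_trans _ _ (\esum_(n in [set: int])
    ((c * normc (x n) `^ p)%:E + (d * normc (y n) `^ p)%:E))%E).
  by apply: le_esum => n _; rewrite -EFinD lee_fin.
rewrite esumD; [|by move=> n _; rewrite lee_fin mulr_ge0 ?powR_ge0..].
have -> : (a + b) `^ p = c * a `^ p + d * b `^ p.
  rewrite /c /d !divfK ?gt_eqF ?powR_gt0// -mulrDr -mulrDl divff ?mulr1//.
  by rewrite gt_eqF.
rewrite EFinD !EFinM; apply: leeD.
  apply: le_trans (lee_wpmul2l _ xa); rewrite ?lee_fin//.
  by apply: esumZ => // n; exact: powR_ge0.
apply: le_trans (lee_wpmul2l _ yb); rewrite ?lee_fin//.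
by apply: esumZ => // n; exact: powR_ge0.
Qed.

Lemma minkowski_lp x y : x \in lp_set -> y \in lp_set ->
  (x + y \in lp_set) /\ lp_norm (x + y) <= lp_norm x + lp_norm y.
Proof.
move=> xp yp; have N0 z : 0 <= lp_norm z by exact: powR_ge0.
have key e : 0 < e ->
    x + y \in lp_set /\ lp_norm (x + y) <= lp_norm x + e + (lp_norm y + e).
  move=> e0; apply: lp_norm_le; first by rewrite !addr_ge0// ltW.
  apply: minkowski_aux; rewrite ?ltr_wpDl// lp_sumE// lee_fin.
    by rewrite ge0_ler_powR ?nnegrE ?lerDl ?addr_ge0 ?(ltW p0) ?(ltW e0).
  by rewrite ge0_ler_powR ?nnegrE ?lerDl ?addr_ge0 ?(ltW p0) ?(ltW e0).
split; first exact: (key 1 ltr01).1.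
apply/ler_addgt0Pr => e e0; have [|_] := key (e / 2); first by rewrite divr_gt0.
by rewrite addrACA -splitr.
Qed.

Let lp_normZ_le (l : R[i]) x : x \in lp_set ->
  l *: x \in lp_set /\ lp_norm (l *: x) <= normc l * lp_norm x.
Proof.
move=> xp; apply: lp_norm_le; first by rewrite mulr_ge0 ?powR_ge0.
rewrite powRM ?powR_ge0// EFinM -lp_sumE//.
apply: le_trans (esumZ (powR_ge0 _ _) _); last by move=> n; exact: powR_ge0.
apply: le_esum => n _.
by rewrite -[(l *: x) n]/(l * x n) normcM powRM.
Qed.

Let lp_sum0 : lp_sum 0 = 0%E.
Proof. by apply: esum1 => n _; rewrite normc0 powR0// gt_eqF. Qed.

Let lp_norm0 : lp_norm 0 = 0.
Proof. by rewrite /lp_norm lp_sum0 powR0// invr_eq0 gt_eqF. Qed.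

Lemma lp_normZ (l : R[i]) x : x \in lp_set ->
  lp_norm (l *: x) = normc l * lp_norm x.
Proof.
move=> xp; have [->|l0] := eqVneq l 0; first by rewrite scale0r lp_norm0 normc0 mul0r.
have [lxp lx] := lp_normZ_le l xp.
apply/eqP; rewrite eq_le lx/=; have [_] := lp_normZ_le l^-1 lxp.
rewrite scalerA mulVf// scale1r normcV ler_pdivlMl// lt0r normc_ge0 andbT.
by apply/eqP => /eq0_normc; exact/eqP.
Qed.

Lemma lp_norm_eq0 x : x \in lp_set -> lp_norm x = 0 -> x = 0.
Proof.
move=> xp x0; apply/funext => n; apply/eq0_normc/(@powR_eq0_eq0 _ _ p)/eqP.
rewrite eq_le powR_ge0 andbT -lee_fin.
have -> : 0%:E = lp_sum x by rewrite lp_sumE// x0 powR0// gt_eqF.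
apply: esum_ge; exists [set n]; last by rewrite fsbig_set1.
by split=> //; exact: finite_set1.
Qed.

Lemma lp_submod_closed : submod_closed lp_set.
Proof.
split; first by apply/lp_setP; rewrite lp_sum0 ltry.
by move=> l x y xp yp; exact: (minkowski_lp (lp_normZ_le l xp).1 yp).1.
Qed.

HB.instance Definition _ :=
  GRing.isSubmodClosed.Build _ _ lp_set lp_submod_closed.

Record lp := Lp { lp_fun :> seqC; lp_funP : lp_fun \in lp_set }.

HB.instance Definition _ := [isSub for lp_fun].
HB.instance Definition _ := [Choice of lp by <:].
HB.instance Definition _ := [SubChoice_isSubLmodule of lp by <:].

Let norm (x : lp) : R[i] := (lp_norm x)%:C.

Let ler_norm_lp (x y : lp) : norm (x + y) <= norm x + norm y.
Proof.
rewrite /norm -rmorphD lecR.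
exact: (minkowski_lp (lp_funP x) (lp_funP y)).2.
Qed.

Let normZ_lp (l : R[i]) (x : lp) : norm (l *: x) = `|l| * norm x.
Proof. by rewrite /norm (lp_normZ l (lp_funP x)) rmorphM. Qed.

Let norm_eq0_lp (x : lp) : norm x = 0 -> x = 0.
Proof.
by move=> /complexI x0; apply/val_inj/lp_norm_eq0 => //; exact: lp_funP.
Qed.

HB.instance Definition _ :=
  Lmodule_isNormed.Build R[i] lp ler_norm_lp normZ_lp norm_eq0_lp.

Definition unit_seq (n : int) : seqC := fun k => (k == n)%:R.

Lemma unit_seqP n : unit_seq n \in lp_set.
Proof.
apply/lp_setP; rewrite /lp_sum (esumID [set n]); last first.
  by move=> k _; rewrite lee_fin powR_ge0.
rewrite setTI esum_set1 ?lee_fin ?powR_ge0// esum1 ?adde0 ?ltry// => k [_ /eqP].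
by rewrite /unit_seq => /negbTE ->; rewrite normc0 powR0// gt_eqF.
Qed.

Definition lp_basis (n : int) : lp := Lp (unit_seqP n).

Definition is_bilateral_shift (w : int -> R[i]) (T : {linear lp -> lp}) :=
  [/\ forall n, w n != 0, exists M, forall n, `|w n| <= M,
      continuous T & forall n, T (lp_basis n) = w n *: lp_basis (n - 1)].

End SequenceSpace.

Arguments lp {R p} p1.

(* Main.v *)
Require Import Defs.
From HB Require Import structures.
From mathcomp Require Import all_boot all_order all_algebra complex.
From mathcomp Require Import cyclic separable cyclotomic finmap ring lra zify.
From mathcomp Require Import all_classical all_reals all_analysis.
Import Order.TTheory GRing.Theory Num.Theory.
Import ComplexField.Normc numFieldNormedType.Exports.

Set Implicit Arguments.
Unset Strict Implicit.
Unset Printing Implicit Defensive.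

Local Open Scope classical_set_scope.
Local Open Scope ring_scope.

(** Why the theorem holds. Write [W j n] for the product of the weights
    [w_(j+1) ... w_(j+n)], so that the coordinate [j] of [T^n x] is
    [W j n * x_(j+n)], and put [fwd k n = |W k n|], [bwd k n = |W (k-n) n|]. If for
    every [k] the numbers [bwd k n] and [1 / fwd k n] are simultaneously small for
    some large [n], then [T] is hypercyclic; if their product is, then [T] is
    supercyclic. In both cases a vector with a dense (projective) orbit is a series
    of finitely supported blocks with supports escaping to the right
    ([universal_vector], [hypercyclic_criterion], [supercyclic_criterion]).

    Conversely, assume that such a condition fails at [k], and let [x] be any vector.
    The orbit of [x] misses a nonempty weakly open set [{y | rho < |y_k|, |g y| < d}].
    Indeed, consider only the vectors [y_n] of the orbit that are large at [k]. A
    functional [g] with [g e_k = 0] and [d <= |g y_n|] for all of them comes from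
    Ball's complex plank theorem ([complex_plank]): in the dual [l_q], [2 <= q], it
    suffices that the parts of the [y_n] supported away from [k] have norms [h_n]
    with [sum_n 1 / h_n^2] finite. This theorem is obtained by maximizing
    [prod_n |g y_n| ^ m_n] on the unit sphere up to a factor [2]: the sphere is smooth
    to the second order, so the product can be tested along complex tangent lines, on
    which Jensen's inequality bounds each factor from below. Finitely many vectors
    are handled at a time, and a weak-star limit handles them all
    ([plank_functional]).

    It remains to find large coordinates. In the projective case, normalize [y_n] by
    [y_n k = 1]; the failure of the condition moves a fixed nonzero coordinate of [x]
    to a coordinate of [y_n] of size at least [c / |x_(k+n)|], and
    [sum_n |x_(k+n)|^2] is finite because [p <= 2]
    ([weakly_supercyclic_supercyclic]). In the other case, if [y_n] and [y_m] are both
    large at [k], then either [y_n] is large at [k + m - n] or [y_m] is large at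
    [k + n - m]. The [i]-th smallest out-degree of the resulting tournament is at
    least [(i - 1) / 2], so, apart from one vector that is excluded by the choice of
    [rho], the norms in the predual of [l_q] satisfy [h_n^2 >= c i^s] with
    [s = 2 (1 - 1/q)]. This exponent exceeds [1] exactly when
    [2 < q], which [p < 2] permits ([weakly_hypercyclic_hypercyclic]). *)

(** * Maximum modulus and Jensen's inequality for polynomials *)

Section MaximumModulus.
Context {R : realType}.
Local Notation C := R[i].
Implicit Types (z : C) (P : {poly C}).

Lemma normc_ge0 z : 0 <= normc z.
Proof. by case: z => ? ?; exact: sqrtr_ge0. Qed.

Lemma normr_normc z : `|z| = (normc z)%:C%C.
Proof. by []. Qed.

Lemma normcX z n : normc (z ^+ n) = normc z ^+ n.
Proof.
by elim: n => [|n IH]; rewrite ?expr0 ?normc1// !exprS normcM IH.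
Qed.

Lemma normc_real (r : R) : 0 <= r -> normc r%:C%C = r.
Proof. by move=> r0; rewrite /normc /= expr0n /= addr0 sqrtr_sqr ger0_norm. Qed.

Lemma normc_conj z : normc z^*%C = normc z.
Proof. by case: z => a b; rewrite /normc /= sqrrN. Qed.

Lemma normc_eq0 z : (normc z == 0) = (z == 0).
Proof.
by apply/eqP/eqP => [/eq0_normc//|->]; rewrite normc0.
Qed.

Lemma normc_gt0 z : (0 < normc z) = (z != 0).
Proof. by rewrite lt0r normc_ge0 andbT normc_eq0. Qed.

Lemma normcB z1 z2 : normc (z1 - z2) = normc (z2 - z1).
Proof. by rewrite -opprB normcN. Qed.

Lemma normc_sum (I : Type) (s : seq I) (F : I -> C) :
  normc (\sum_(i <- s) F i) <= \sum_(i <- s) normc (F i).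
Proof.
elim: s => [|i s IH]; first by rewrite !big_nil normc0.
by rewrite !big_cons (le_trans (le_normcD _ _))// lerD2l.
Qed.

Lemma normc_prod (I : Type) (s : seq I) (F : I -> C) :
  normc (\prod_(i <- s) F i) = \prod_(i <- s) normc (F i).
Proof.
elim: s => [|i s IH]; first by rewrite !big_nil normc1.
by rewrite !big_cons normcM IH.
Qed.

Lemma primitive_root_exists n : (0 < n)%N -> exists z : C, n.-primitive_root z.
Proof.
move=> n_gt0; pose p : {poly C} := 'X^n - 1.
have [r Dp] := closed_field_poly_normal p.
rewrite (monicP _) ?monicXnsubC// scale1r in Dp.
have rn1 : all n.-unity_root r by apply/allP => z; rewrite -root_prod_XsubC -Dp.
have sz_r : (n < (size r).+1)%N.
  by rewrite -(size_prod_XsubC r id) -Dp size_XnsubC.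
have [|z] := hasP (has_prim_root n_gt0 rn1 _ sz_r); last by exists z.
by rewrite -separable_prod_XsubC -Dp separable_Xn_sub_1// pnatr_eq0 -lt0n.
Qed.

Lemma sum_primitive_root n j z : n.-primitive_root z ->
  \sum_(i < n) (z ^+ i) ^+ j = if (n %| j)%N then n%:R else 0.
Proof.
move=> zn; case: ifPn => [/dvdnP[k ->]|nj].
  rewrite (eq_bigr (fun=> 1)) ?sumr_const ?card_ord// => i _.
  by rewrite mulnC -exprM mulnCA exprM (prim_expr_order zn) expr1n.
have zj1 : z ^+ j != 1 by rewrite -(prim_order_dvd zn).
apply: (mulfI (_ : z ^+ j - 1 != 0)); first by rewrite subr_eq0.
rewrite mulr0 -[RHS](_ : (z ^+ j) ^+ n - 1 = 0); last first.
  by rewrite -exprM mulnC exprM (prim_expr_order zn) expr1n subrr.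
rewrite [RHS]subrX1; congr (_ * _); apply: eq_bigr => i _.
by rewrite -!exprM mulnC.
Qed.

(** Averaging over the [n]-th roots of unity kills every monomial of degree
    strictly between [0] and [n], so the value at the centre is a mean of values
    on the circle. *)
Lemma poly_maximum_modulus P (r B : R) : 0 <= r ->
  (forall z, normc z = r -> normc P.[z] <= B) -> normc P.[0] <= B.
Proof.
move=> r0 PB; pose n := (size P).+1; have n0 : (0 < n)%N by [].
have [w wn] := primitive_root_exists n0.
have normw i : normc (w ^+ i) = 1.
  have wn1 : normc w ^+ n = 1 by rewrite -normcX (prim_expr_order wn) normc1.
  have /eqP w1 : normc w == 1 by rewrite -(@pexpr_eq1 _ _ n) ?normc_ge0// wn1.
  by rewrite normcX w1 expr1n.
have mean : \sum_(i < n) P.[r%:C%C * w ^+ i] = n%:R * P.[0].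
  under eq_bigr do rewrite horner_coef.
  rewrite exchange_big /= horner_coef0.
  transitivity (\sum_(j < size P) P`_j * r%:C%C ^+ j * \sum_(i < n) (w ^+ i) ^+ j).
    apply: eq_bigr => j _; rewrite mulr_sumr; apply: eq_bigr => i _.
    by rewrite exprMn mulrA.
  have [P0|P0] := posnP (size P).
    by rewrite P0 big_ord0 nth_default ?P0// mulr0.
  rewrite -(prednK P0) big_ord_recl expr0 mulr1 (sum_primitive_root _ wn) dvdn0.
  rewrite big1 ?addr0 1?mulrC// => i _.
  rewrite (sum_primitive_root _ wn) gtnNdvd ?mulr0//.
  by have := ltn_ord i; rewrite /n /= /bump /=; lia.
have nR : 0 < n%:R :> R by rewrite ltr0n.
rewrite -(ler_pM2l nR).
have -> : n%:R * normc P.[0] = normc (\sum_(i < n) P.[r%:C%C * w ^+ i]).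
  by rewrite mean normcM -[n%:R : C](rmorph_nat (real_complex R)) normc_real// ler0n.
apply: (le_trans (normc_sum _ _)).
apply: (@le_trans _ _ (\sum_(i < n) B)); last by rewrite sumr_const card_ord mulr_natl.
by apply: ler_sum => i _; apply: PB; rewrite normcM normc_real// normw mulr1.
Qed.

(** A one-factor form of Jensen's inequality: on the circle of radius [r], the
    factor [1 + b z] has the same modulus as its Blaschke reflection
    [(z + r^2 c) / r] with [c] the conjugate of [b], of value [r c] at the centre. *)
Lemma jensen_factor (b : C) P n (r B : R) : 0 < r ->
  (forall z, normc z = r -> normc ((1 + b * z) ^+ n * P.[z]) <= B) ->
  (r * normc b) ^+ n * normc P.[0] <= B.
Proof.
move=> r0 H.
pose c : C := (r ^+ 2)%:C%C * b^*%C.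
pose Q : {poly C} := (r^-1)%:C%C *: ('X + c%:P).
have Qz z : normc z = r -> normc Q.[z] = normc (1 + b * z).
  move=> zr; rewrite /Q !hornerE normcM normc_real ?invr_ge0 ?(ltW r0)//.
  have -> : z + c = z * (1 + b * z)^*%C.
    rewrite rmorphD rmorph1 rmorphM mulrDr mulr1 mulrCA -[z * _]sqr_normc.
    by rewrite normr_normc zr -rmorphXn /c mulrC.
  by rewrite normcM zr normc_conj mulKf ?gt_eqF.
have Q0 : normc Q.[0] = r * normc b.
  rewrite /Q !hornerE /c !normcM !normc_real ?invr_ge0 ?exprn_ge0 ?(ltW r0)//.
  by rewrite normc_conj expr2 mulKf ?gt_eqF.
have := @poly_maximum_modulus (Q ^+ n * P) r B (ltW r0).
rewrite hornerM horner_exp normcM normcX Q0; apply => z zr.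
by rewrite hornerM horner_exp normcM normcX Qz// -normcX -normcM H.
Qed.

End MaximumModulus.

(** * Second-order smoothness of the q-th power of the modulus *)

Section SmoothPower.
Context {R : realType}.
Local Notation C := R[i].

Lemma powR_le_tangent1 (y t : R) : 0 <= y -> 0 <= t -> t <= 1 ->
  y `^ t <= 1 + t * (y - 1).
Proof.
rewrite le_eqVlt => /predU1P[<- t0 t1|y0 t0 t1].
  have [->|tn0] := eqVneq t 0; first by rewrite powRr0 mul0r addr0.
  by rewrite powR0// sub0r mulrN1 subr_ge0.
have := @convex_expR R (Itv01 t0 t1) (ln y) 0.
rewrite !convRE /= mulr0 addr0 expR0 mulr1 lnK ?posrE// /unstable.onem.
rewrite /powR gt_eqF// => /le_trans; apply.
by rewrite le_eqVlt; apply/orP; left; apply/eqP; ring.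
Qed.

(** Bernoulli's inequality for the exponent [s - 1], multiplied by [1 + u]. *)
Lemma powR_le_taylor2 (u s : R) : -1 <= u -> 1 <= s -> s <= 2 ->
  (1 + u) `^ s <= 1 + s * u + (s - 1) * u ^+ 2.
Proof.
move=> u1 s1 s2; have u0 : 0 <= 1 + u by lra.
rewrite -mulr_powRB1 ?(lt_le_trans ltr01)//.
have := @powR_le_tangent1 (1 + u) (s - 1) u0; rewrite subr_ge0 => /(_ s1) H.
have {}H := H ltac:(lra); apply: (le_trans (ler_wpM2l u0 H)).
by rewrite le_eqVlt; apply/orP; left; apply/eqP; ring.
Qed.

(** A quantitative form of the differentiability of [|z| ^ q]: here [a], [d],
    [X] stand for the modulus of the base point, the modulus of the direction
    and the real part of the hermitian product with the increment. *)
Lemma powR_smooth (q a d r X : R) : 2 <= q <= 3 -> 0 <= a -> 0 <= d ->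
  0 <= r <= 1 -> `|X| <= a * (r * d) ->
  (a ^+ 2 + 2 * X + (r * d) ^+ 2) `^ (q / 2) <=
  a `^ q + q * (a `^ (q - 2) * X) + 11 * r ^+ 2 * (a `^ q + d `^ q).
Proof.
move=> /andP[q2 q3] a0 d0 /andP[r0 r1] Xad.
have q0 : q != 0 by lra.
have sq (x : R) : 0 <= x -> (x ^+ 2) `^ (q / 2) = x `^ q.
  move=> x0; rewrite -powR_mulrn// -powRrM; congr (_ `^ _); rewrite mulrC divfK// pnatr_eq0.
have qs (x : R) : 0 <= x -> x `^ (q - 2) * x ^+ 2 = x `^ q.
  move=> x0; rewrite -powR_mulrn// -powRD ?subrK//; apply/implyP => /eqP; lra.
have lq (x y : R) : 0 <= x -> x <= y -> x `^ q <= y `^ q.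
  by move=> x0 xy; rewrite ge0_ler_powR ?nnegrE//; lra.
have lq2 (x y : R) : 0 <= x -> x <= y -> x `^ (q - 2) <= y `^ (q - 2).
  by move=> x0 xy; rewrite ge0_ler_powR ?nnegrE//; lra.
set e := r * d in Xad *; have e0 : 0 <= e by rewrite mulr_ge0.
have Aq := powR_ge0 a q; have Dq := powR_ge0 d q.
have A2 := powR_ge0 a (q - 2).
have r2 : 0 <= r ^+ 2 by rewrite sqr_ge0.
(* the expansion at the base point is useful only while the increment is
   smaller than the base point; beyond, every term is at most [e ^ q] *)
have [ea|ae] := leP e a.
  have [a00|an0] := eqVneq a 0.
    have e00 : e = 0 by lra.
    have -> : X = 0.
      by apply/eqP; rewrite -normr_le0 (le_trans Xad)// a00 mul0r.
    have q20 : q / 2 != 0 by rewrite gt_eqF//; lra.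
    by rewrite a00 e00 !mulr0 !expr0n !addr0 !powR0// !add0r !mulr_ge0.
  have ap : 0 < a by rewrite lt0r an0.
  pose u := (2 * X + e ^+ 2) / a ^+ 2.
  have a2p : 0 < a ^+ 2 by rewrite exprn_gt0.
  have -> : a ^+ 2 + 2 * X + e ^+ 2 = a ^+ 2 * (1 + u).
    by rewrite /u; field.
  have u1 : -1 <= u.
    rewrite ler_pdivlMr// mulN1r -subr_ge0.
    have /ler_normlP[X1 _] := Xad.
    have := sqr_ge0 (a - e); lra.
  have ea2 : e ^+ 2 <= a * e by rewrite expr2 ler_wpM2r.
  have u2 : a ^+ 2 * u ^+ 2 <= 9 * e ^+ 2.
    have -> : a ^+ 2 * u ^+ 2 = (2 * X + e ^+ 2) ^+ 2 / a ^+ 2 by rewrite /u; field.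
    rewrite ler_pdivrMr// -ler_sqrt ?mulr_ge0 ?sqr_ge0//.
    have -> : 9 * e ^+ 2 * a ^+ 2 = (3 * (a * e)) ^+ 2 by ring.
    rewrite !sqrtr_sqr [leRHS]ger0_norm ?mulr_ge0//.
    have /ler_normlP[X1 X2] := Xad.
    by apply/ler_normlP; split; have := sqr_ge0 e; lra.
  rewrite powRM ?sqr_ge0 ?sq//; last by lra.
  have := @powR_le_taylor2 u (q / 2) u1 ltac:(lra) ltac:(lra).
  move=> /(ler_wpM2l Aq)/le_trans; apply.
  have ad2 : a `^ (q - 2) * d ^+ 2 <= a `^ q + d `^ q.
    have [ad|da] := leP a d.
      by apply: (@le_trans _ _ (d `^ q)); rewrite ?lerDr// -(qs d)// ler_wpM2r ?sqr_ge0// lq2.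
    apply: (@le_trans _ _ (a `^ q)); rewrite ?lerDl// -(qs a)// ler_wpM2l//.
    by rewrite ler_sqr ?nnegrE// ltW.
  rewrite -[in leLHS](qs a)//.
  have -> : a `^ (q - 2) * a ^+ 2 * (1 + q / 2 * u + (q / 2 - 1) * u ^+ 2) =
    a `^ (q - 2) * a ^+ 2 + q * (a `^ (q - 2) * X) +
    a `^ (q - 2) * (q / 2 * e ^+ 2 + (q / 2 - 1) * (a ^+ 2 * u ^+ 2)).
    by rewrite /u; field.
  rewrite qs// lerD2l.
  apply: (@le_trans _ _ (a `^ (q - 2) * (11 * e ^+ 2))).
    rewrite ler_wpM2l//; have := sqr_ge0 e => es.
    have h1 : q / 2 * e ^+ 2 <= 3 / 2 * e ^+ 2 by rewrite ler_wpM2r//; lra.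
    have h2 : (q / 2 - 1) * (a ^+ 2 * u ^+ 2) <= 2^-1 * (9 * e ^+ 2).
      by apply: ler_pM => //; [lra|rewrite mulr_ge0 ?sqr_ge0|lra].
    lra.
  have -> : a `^ (q - 2) * (11 * e ^+ 2) = 11 * r ^+ 2 * (a `^ (q - 2) * d ^+ 2).
    by rewrite /e; ring.
  by rewrite ler_wpM2l// mulr_ge0.
have Eq : e `^ q <= r ^+ 2 * d `^ q.
  rewrite powRM//; apply: ler_wpM2r => //.
  have [->|rn0] := eqVneq r 0; first by rewrite powR0// expr0n.
  rewrite -powR_mulrn//; apply: ger_powR => //.
  by rewrite r1 andbT lt0r rn0.
have h1 : (a ^+ 2 + 2 * X + e ^+ 2) `^ (q / 2) <= 8 * e `^ q.
  apply: (@le_trans _ _ ((2 * e) `^ q)).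
    rewrite -sq ?mulr_ge0//; apply: ge0_ler_powR; rewrite ?nnegrE ?sqr_ge0//; first by lra.
      have /ler_normlP[X1 X2] := Xad; have := sqr_ge0 (a - e); lra.
    have /ler_normlP[X1 X2] := Xad.
    have : a * e <= e * e by rewrite ler_wpM2r// ltW.
    have : a * a <= e * e by rewrite ler_pM// ltW.
    rewrite !expr2; lra.
  rewrite powRM//; apply: ler_wpM2r; first exact: powR_ge0.
  have -> : 8 = 2 `^ 3 :> R by rewrite -[3]/(3%:R) powR_mulrn//; ring.
  by apply: ler_powR => //; lra.
have h2 : - (q * (a `^ (q - 2) * X)) <= 3 * e `^ q.
  have [X0|X0] := leP 0 X.
    apply: (@le_trans _ _ 0); rewrite ?oppr_le0 ?mulr_ge0 ?powR_ge0//; lra.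
  rewrite -!mulrN; apply: ler_pM; rewrite ?mulr_ge0 ?oppr_ge0 ?(ltW X0)//; first lra.
  rewrite -(qs e)//; apply: ler_pM; rewrite ?oppr_ge0 ?(ltW X0) ?lq2 ?(ltW ae)//.
  move: Xad; rewrite ltr0_norm// => /le_trans; apply.
  by rewrite expr2 ler_wpM2r// ltW.
have h3 : 11 * (r ^+ 2 * d `^ q) <= 11 * r ^+ 2 * (a `^ q + d `^ q).
  by rewrite mulrA ler_wpM2l ?mulr_ge0// lerDr.
lra.
Qed.

(** [2 <= q] makes [|z| ^ q] twice differentiable with controlled second
    derivative; the increment is a complex multiple [v * d] because the
    estimate has to be quadratic in [|v|] uniformly in the direction [d]. *)
Lemma normc_powR_smooth (q : R) (z d v : C) : 2 <= q <= 3 -> normc v <= 1 ->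
  normc (z + v * d) `^ q <= normc z `^ q
    + q * complex.Re (v * ((normc z `^ (q - 2))%:C%C * z^*%C * d))
    + 11 * normc v ^+ 2 * (normc z `^ q + normc d `^ q).
Proof.
move=> q23 v1; set X := complex.Re (v * (z^*%C * d)).
have -> : complex.Re (v * ((normc z `^ (q - 2))%:C%C * z^*%C * d)) =
    normc z `^ (q - 2) * X.
  rewrite /X; case: (v) (z) (d) => [v1' v2] [z1 z2] [d1 d2] /=; ring.
have nE (x : C) : normc x ^+ 2 = complex.Re x ^+ 2 + complex.Im x ^+ 2.
  by case: x => x1 x2; rewrite /= sqr_sqrtr// addr_ge0 ?sqr_ge0.
have XN : `|X| <= normc z * (normc v * normc d).
  apply: (@le_trans _ _ (normc (v * (z^*%C * d)))).
    rewrite -ler_sqr ?nnegrE ?normc_ge0// real_normK ?num_real// nE.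
    by rewrite lerDl sqr_ge0.
  by rewrite !normcM normc_conj mulrCA.
have nq (x : C) : normc x `^ q = (normc x ^+ 2) `^ (q / 2).
  rewrite -powR_mulrn ?normc_ge0// -powRrM; congr (_ `^ _).
  by rewrite mulrC divfK// pnatr_eq0.
have -> : normc (z + v * d) `^ q =
    (normc z ^+ 2 + 2 * X + (normc v * normc d) ^+ 2) `^ (q / 2).
  rewrite nq; congr (_ `^ _); rewrite exprMn !nE /X.
  case: (v) (z) (d) => [v1' v2] [z1 z2] [d1 d2] /=; ring.
by apply: powR_smooth; rewrite ?normc_ge0.
Qed.

End SmoothPower.

(** * A complex plank theorem in l_q *)

Section ComplexPlank.
Context {R : realType} {J : eqType}.
Local Notation C := R[i].
Implicit Types (s : seq J) (y f g d : J -> C) (q : R).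

Definition pairing s y f : C := \sum_(i <- s) y i * f i.

Definition power_sum q s f : R := \sum_(i <- s) normc (f i) `^ q.

Lemma pairing_comb s y f g (a b : C) :
  pairing s y (fun i => a * f i + b * g i) = a * pairing s y f + b * pairing s y g.
Proof.
rewrite /pairing !mulr_sumr -big_split; apply: eq_bigr => i _ /=; ring.
Qed.

Lemma pairingZ s y f (a : C) : pairing s y (fun i => a * f i) = a * pairing s y f.
Proof. by rewrite /pairing mulr_sumr; apply: eq_bigr => i _; ring. Qed.

Lemma power_sum_ge0 q s f : 0 <= power_sum q s f.
Proof. by apply: sumr_ge0 => i _; exact: powR_ge0. Qed.

Lemma power_sumZ q s f (a : C) :
  power_sum q s (fun i => a * f i) = normc a `^ q * power_sum q s f.
Proof.
rewrite /power_sum mulr_sumr; apply: eq_bigr => i _.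
by rewrite normcM powRM ?normc_ge0.
Qed.

Lemma power_sum_le1 q s f i : 0 < q -> power_sum q s f <= 1 -> i \in s ->
  normc (f i) <= 1.
Proof.
move=> q0 f1 si; rewrite leNgt; apply/negP => fi; move: f1; apply/negP.
rewrite -ltNge; apply: (@lt_le_trans _ _ (normc (f i) `^ q)).
  have -> : 1 = 1 `^ q :> R by rewrite powR1.
  by rewrite gt0_ltr_powR ?nnegrE ?normc_ge0.
rewrite /power_sum (big_rem i)//= lerDl sumr_ge0// => j _; exact: powR_ge0.
Qed.

Lemma pairing_neq0_power_sum q s y f : pairing s y f != 0 -> 0 < power_sum q s f.
Proof.
move=> yf; rewrite lt0r power_sum_ge0 andbT; apply: contra yf => f0.
rewrite /pairing big_seq big1// => i si.
move: f0; rewrite /power_sum (big_rem i)//= paddr_eq0 ?powR_ge0//; last first.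
  by apply: sumr_ge0 => j _; exact: powR_ge0.
by move=> /andP[/eqP/powR_eq0_eq0/eq0_normc -> _]; rewrite mulr0.
Qed.

Let weighted_le (a b q : R) : 2 <= q -> 0 <= a -> 0 <= b ->
  a `^ (q - 2) * a * b <= a `^ q + b `^ q.
Proof.
move=> q2 a0 b0.
have qs (x : R) : 0 <= x -> x `^ (q - 2) * x ^+ 2 = x `^ q.
  move=> x0; rewrite -powR_mulrn// -powRD ?subrK//; apply/implyP => /eqP; lra.
have aq := powR_ge0 a q; have bq := powR_ge0 b q.
have aq2 := powR_ge0 a (q - 2).
have [ab|ba] := leP a b.
  apply: (@le_trans _ _ (b `^ q)); rewrite ?lerDr// -(qs b)// expr2 mulrA.
  rewrite ler_wpM2r// ler_pM// ge0_ler_powR ?nnegrE//; lra.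
apply: (@le_trans _ _ (a `^ q)); rewrite ?lerDl// -(qs a)// expr2 mulrA.
by rewrite ler_wpM2l ?mulr_ge0// ltW.
Qed.

Let sum_le (a b q : R) : 2 <= q <= 3 -> 0 <= a -> 0 <= b ->
  (b + 2 * a) `^ q <= 27 * (a `^ q + b `^ q).
Proof.
move=> /andP[q2 q3] a0 b0; pose m := Num.max a b.
have m0 : 0 <= m by rewrite le_max a0.
have am : a <= m by rewrite le_max lexx.
have bm : b <= m by rewrite le_max lexx orbT.
apply: (@le_trans _ _ ((3 * m) `^ q)).
  by apply: ge0_ler_powR; rewrite ?nnegrE; lra.
rewrite powRM//; apply: ler_pM; rewrite ?powR_ge0//.
  have -> : 27 = 3 `^ 3 :> R by rewrite -[X in _ `^ X]/(3%:R) powR_mulrn//; ring.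
  by apply: ler_powR => //; lra.
rewrite /m /Num.max; case: ifP => _; rewrite ?lerDl ?lerDr; exact: powR_ge0.
Qed.

(** Uniform smoothness of the unit spheres of [l_q]: subtracting from [g] a
    multiple of [f] makes the direction tangent to the sphere at [f], and
    tangent moves change the power sum only to second order. *)
Definition tangent_smoothness (K : R) :=
  forall q s f g, 2 <= q <= 3 -> power_sum q s f = 1 -> power_sum q s g <= 1 ->
  exists2 k : C, normc k <= 2 & forall v : C, normc v <= 1 ->
    power_sum q s (fun i => f i + v * (g i - k * f i)) <= 1 + K * normc v ^+ 2.

Lemma tangent_smoothness_exists : exists2 K, 1 <= K & tangent_smoothness K.
Proof.
exists 605 => [|q s f g q23 f1 g1]; first by rewrite ler1n.
 have /andP[q2 q3] := q23.
(* [q * t] is the derivative of the power sum at [f], and [t] norms [f] *)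
pose t i : C := (normc (f i) `^ (q - 2))%:C%C * (f i)^*%C.
pose k := \sum_(i <- s) t i * g i.
have nt i : normc (t i) = normc (f i) `^ (q - 2) * normc (f i).
  by rewrite /t normcM normc_real ?powR_ge0// normc_conj.
have tf : \sum_(i <- s) t i * f i = 1.
  rewrite -[RHS](rmorph1 (real_complex R)) -f1 rmorph_sum; apply: eq_bigr => i _.
  rewrite /t -mulrA [_^*%C * _]mulrC -sqr_normc normr_normc -rmorphXn -rmorphM.
  congr (_%:C%C); rewrite -powR_mulrn ?normc_ge0// -powRD ?subrK//.
  by apply/implyP => /eqP; lra.
have k2 : normc k <= 2.
  apply: (le_trans (normc_sum _ _)).
  apply: (@le_trans _ _ (power_sum q s f + power_sum q s g)); last by lra.
  rewrite /power_sum -big_split; apply: ler_sum => i _ /=.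
  by rewrite normcM nt weighted_le ?normc_ge0.
exists k => // v v1; pose d i := g i - k * f i.
have td : \sum_(i <- s) t i * d i = 0.
  rewrite (eq_bigr (fun i => t i * g i - k * (t i * f i))); last by move=> i _; rewrite /d; ring.
  by rewrite big_split /= sumrN -mulr_sumr tf mulr1 subrr.
have d54 : power_sum q s d <= 54.
  apply: (@le_trans _ _ (27 * (power_sum q s f + power_sum q s g))); last by lra.
  rewrite /power_sum -big_split mulr_sumr; apply: ler_sum => i _ /=.
  apply: le_trans (sum_le q23 (normc_ge0 _) (normc_ge0 _)).
  apply: ge0_ler_powR; rewrite ?nnegrE ?addr_ge0 ?mulr_ge0 ?normc_ge0//; first by lra.
  rewrite (le_trans (le_normcD _ _))// lerD2l normcN normcM.
  by rewrite ler_wpM2r ?normc_ge0.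
apply: (@le_trans _ _ (\sum_(i <- s) (normc (f i) `^ q
    + q * complex.Re (v * (t i * d i))
    + 11 * normc v ^+ 2 * (normc (f i) `^ q + normc (d i) `^ q)))).
  by apply: ler_sum => i _; apply: normc_powR_smooth.
rewrite !big_split /= -!mulr_sumr big_split /=.
have -> : \sum_(i <- s) complex.Re (v * (t i * d i)) =
    complex.Re (v * \sum_(i <- s) t i * d i).
  by rewrite mulr_sumr raddf_sum.
rewrite td mulr0 /= mulr0 addr0.
rewrite -/(power_sum q s f) -/(power_sum q s d) f1 lerD2l.
have -> : 605 * normc v ^+ 2 = 11 * normc v ^+ 2 * 55 by ring.
apply: ler_wpM2l; last by lra.
by rewrite mulr_ge0// sqr_ge0.
Qed.

Context {L : eqType}.
Implicit Types (r : seq L) (Y G : L -> J -> C) (m : L -> nat).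

(** Finitely many hyperplanes do not cover the space: [f + t G k] leaves them all
    as soon as [t] exceeds the modulus of every root of the affine functions
    involved. *)
Lemma common_nonvanishing s r Y G :
  (forall k, k \in r -> pairing s (Y k) (G k) != 0) ->
  exists f, forall k, k \in r -> pairing s (Y k) f != 0.
Proof.
elim: r => [|k r IH] H; first by exists (fun=> 0).
have [|f Hf] := IH; first by move=> l lr; apply: H; rewrite inE lr orbT.
pose bad l := normc (pairing s (Y l) f / pairing s (Y l) (G k)).
pose t : R := 1 + \sum_(l <- k :: r) bad l.
have t0 : 0 <= t by rewrite addr_ge0// sumr_ge0// => l _; exact: normc_ge0.
exists (fun i => 1 * f i + t%:C%C * G k i) => l lr.
rewrite pairing_comb mul1r; have [Gl|Gl] := eqVneq (pairing s (Y l) (G k)) 0.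
  rewrite Gl mulr0 addr0; apply: Hf; move: lr; rewrite inE => /predU1P[lk|//].
  by have := H k (mem_head _ _); rewrite -{1}lk Gl eqxx.
apply/eqP => e0.
have : normc t%:C%C = bad l.
  rewrite /bad -[RHS]normcN; congr normc; apply: (mulIf Gl).
  by rewrite mulNr divfK//; apply/eqP; rewrite -addr_eq0 addrC e0.
rewrite normc_real// => tb; have : bad l <= t - 1.
  rewrite /t addrAC subrr add0r (big_rem l)//= lerDl sumr_ge0// => j _.
  exact: normc_ge0.
lra.
Qed.

Definition pairing_product s r Y m f : R :=
  \prod_(k <- r) normc (pairing s (Y k) f) ^+ m k.

Lemma pairing_productZ s r Y m f (a : C) :
  pairing_product s r Y m (fun i => a * f i) =
  normc a ^+ (\sum_(k <- r) m k) * pairing_product s r Y m f.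
Proof.
rewrite /pairing_product -prodrXr -big_split; apply: eq_bigr => k _.
by rewrite pairingZ normcM exprMn.
Qed.

Lemma pairing_product_ge0 s r Y m f : 0 <= pairing_product s r Y m f.
Proof. by apply: prodr_ge0 => k _; rewrite exprn_ge0 ?normc_ge0. Qed.

Lemma pairing_product_gt0 s r Y m f :
  (forall k, k \in r -> pairing s (Y k) f != 0) -> 0 < pairing_product s r Y m f.
Proof.
by move=> H; rewrite /pairing_product big_seq prodr_gt0// => k kr;
   rewrite exprn_gt0// normc_gt0 H.
Qed.

(** The factor [2] makes the existence of [f] immediate, without compactness; it is
    harmless because only the [m k]-th root of the inequality matters later. *)
Lemma near_maximizer q s r Y m : 0 < q ->
  (exists f, forall k, k \in r -> pairing s (Y k) f != 0) ->
  exists f, [/\ power_sum q s f <= 1, 0 < pairing_product s r Y m f &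
    forall g, power_sum q s g <= 1 ->
      pairing_product s r Y m g <= 2 * pairing_product s r Y m f].
Proof.
move=> q0 [f0 Hf0].
pose E := [set pairing_product s r Y m g | g in [set g | power_sum q s g <= 1]].
have E_ub : has_ubound E.
  exists (\prod_(k <- r) (\sum_(i <- s) normc (Y k i)) ^+ m k) => _ [g /= g1 <-].
  apply: ler_prod => k _; rewrite exprn_ge0 ?normc_ge0//=.
  apply: lerXn2r; rewrite ?nnegrE ?normc_ge0//.
    by apply: sumr_ge0 => i _; exact: normc_ge0.
  apply: (le_trans (normc_sum _ _)); rewrite [leLHS]big_seq [leRHS]big_seq.
  apply: ler_sum => i si; rewrite normcM ler_piMr ?normc_ge0//.
  exact: power_sum_le1 g1 si.
pose c : R := (1 + power_sum q s f0) `^ - q^-1.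
have S0 := power_sum_ge0 q s f0.
have S1 : 0 < 1 + power_sum q s f0 by rewrite ltr_pwDl.
have c0 : 0 < c by rewrite powR_gt0.
have f1E : power_sum q s (fun i => c%:C%C * f0 i) <= 1.
  rewrite power_sumZ normc_real ?(ltW c0)// /c -powRrM mulNr mulVf ?gt_eqF//.
  by rewrite powR_inv1 ?(ltW S1)// mulrC ler_pdivrMr// mul1r lerDr.
have E1 : E (pairing_product s r Y m (fun i => c%:C%C * f0 i)) by exists (fun i => c%:C%C * f0 i).
have E_sup : has_sup E by split => //; exists (pairing_product s r Y m (fun i => c%:C%C * f0 i)).
have sup0 : 0 < sup E.
  apply: lt_le_trans (ub_le_sup E_ub E1); apply: pairing_product_gt0 => k kr.
  by rewrite pairingZ mulf_neq0 ?Hf0// fmorph_eq0 gt_eqF.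
have e0 : 0 < sup E / 2 by rewrite divr_gt0.
have [_ [f /= f1 <-] fsup] := sup_adherent e0 E_sup.
exists f; split => //; first by lra.
move=> g g1; apply: (@le_trans _ _ (sup E)); last by lra.
by apply: ub_le_sup => //; exists g.
Qed.

(** Moving a near-maximizer [f] by [v] times a tangent direction multiplies the
    product by [prod_k (1 + b_k v) ^ m_k] and leaves the unit ball only to second
    order in [|v| = rho]; Jensen's inequality then bounds [rho |b_k0|]. The radius is
    chosen so that the second-order loss is [expR (m k0)]. *)
Lemma near_maximizer_pairing (K : R) q s r Y m f g k0 :
  1 <= K -> tangent_smoothness K -> 2 <= q <= 3 -> k0 \in r -> (0 < m k0)%N ->
  power_sum q s f = 1 -> 0 < pairing_product s r Y m f ->
  (forall g, power_sum q s g <= 1 ->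
    pairing_product s r Y m g <= 2 * pairing_product s r Y m f) ->
  power_sum q s g <= 1 ->
  (m k0)%:R * normc (pairing s (Y k0) g) ^+ 2 <=
  16 * K * expR 2 * (\sum_(k <- r) m k)%:R * normc (pairing s (Y k0) f) ^+ 2.
Proof.
move=> K1 HK q23 k0r m0 f1 Ff0 fmax g1; have /andP[q2 q3] := q23.
have K0 : 0 < K by rewrite (lt_le_trans ltr01).
set N := (\sum_(k <- r) m k)%N; set h := normc (pairing s (Y k0) g).
set a := normc (pairing s (Y k0) f).
have fn0 k : k \in r -> (0 < m k)%N -> pairing s (Y k) f != 0.
  move=> kr mk; apply: contraTneq Ff0 => f0.
  rewrite /pairing_product (big_rem k)//= f0 normc0 expr0n gtn_eqF//.
  by rewrite mul0r ltxx.
have a0 : 0 < a by rewrite normc_gt0 fn0.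
have h0 : 0 <= h by exact: normc_ge0.
have mN : (m k0 <= N)%N by rewrite /N (big_rem k0)//= leq_addr.
have N0 : (0 < N)%N := leq_trans m0 mN.
have NR : 0 < N%:R :> R by rewrite ltr0n.
have mR : 0 < (m k0)%:R :> R by rewrite ltr0n.
have mNR : (m k0)%:R <= N%:R :> R by rewrite ler_nat.
have e2 : 1 <= expR 2 :> R by have := expR_ge1Dx (2 : R); lra.
(* if [h <= 4 a], the bound is immediate; otherwise the tangent direction pairs with
   [Y k0] at least half as strongly as [g] does *)
have [ha|ah] := leP h (4 * a).
  apply: (@le_trans _ _ (N%:R * (4 * a) ^+ 2)).
    by apply: ler_pM; rewrite ?sqr_ge0 ?(ltW mR)// ler_sqr ?nnegrE// mulr_ge0// ltW.
  have -> : N%:R * (4 * a) ^+ 2 = 16 * N%:R * a ^+ 2 by ring.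
  apply: ler_wpM2r; first exact: sqr_ge0.
  apply: ler_wpM2r; first exact: ltW.
  by rewrite -mulrA ler_peMr// mulr_ege1.
have [kap kap2 Hd] := HK q s f g q23 f1 g1.
pose b k := (pairing s (Y k) g - kap * pairing s (Y k) f) / pairing s (Y k) f.
have pf (v : C) k : k \in r -> (0 < m k)%N ->
    pairing s (Y k) (fun i => f i + v * (g i - kap * f i)) =
    pairing s (Y k) f * (1 + b k * v).
  move=> kr mk; have fk := fn0 k kr mk.
  have -> : (fun i => f i + v * (g i - kap * f i)) =
      (fun i => (1 - v * kap) * f i + v * g i) by apply/funext => i; ring.
  by rewrite pairing_comb /b; field.
have bh : h <= 2 * a * normc (b k0).
  have -> : 2 * a * normc (b k0) =
      2 * normc (pairing s (Y k0) g - kap * pairing s (Y k0) f).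
    rewrite -mulrA -normcM [_ * b k0]mulrC /b divfK// fn0//.
  have : h <= normc (pairing s (Y k0) g - kap * pairing s (Y k0) f) + 2 * a.
    rewrite /h -[X in normc X <= _](subrK (kap * pairing s (Y k0) f)).
    apply: (le_trans (le_normcD _ _)); rewrite lerD2l normcM.
    by rewrite ler_wpM2r// normc_ge0.
  lra.
pose rho : R := Num.sqrt ((m k0)%:R / (K * N%:R)).
have rho2 : rho ^+ 2 = (m k0)%:R / (K * N%:R).
  rewrite sqr_sqrtr//; apply: divr_ge0; first exact: ltW.
  exact: ltW (mulr_gt0 K0 NR).
have rho0 : 0 < rho by rewrite sqrtr_gt0 divr_gt0// mulr_gt0.
have rho1 : rho <= 1.
  rewrite -sqrtr1 ler_wsqrtr// ler_pdivrMr ?mulr_gt0// mul1r.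
  by apply: (le_trans mNR); rewrite ler_peMl// ltW.
pose lam : R := expR (K * rho ^+ 2).
have lam1 : 1 <= lam by rewrite -expR0 ler_expR mulr_ge0 ?sqr_ge0// ltW.
have lam0 : 0 < lam by exact: expR_gt0.
have lamN : lam ^+ N = expR (m k0)%:R.
  rewrite /lam -expRM_natl rho2; congr expR; field.
  by rewrite !gt_eqF.
pose P : {poly C} := \prod_(k <- rem k0 r) (1 + b k *: 'X) ^+ m k.
have Pv v : (1 + b k0 * v) ^+ m k0 * P.[v] = \prod_(k <- r) (1 + b k * v) ^+ m k.
  rewrite (big_rem k0)//= /P horner_prod; congr (_ * _); apply: eq_bigr => k _.
  by rewrite horner_exp !hornerE.
have P0 : P.[0] = 1.
  rewrite /P horner_prod big1// => k _.
  by rewrite horner_exp !hornerE ?(mulr0, addr0) expr1n.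
have H v : normc v = rho ->
    normc ((1 + b k0 * v) ^+ m k0 * P.[v]) <= 2 * expR (m k0)%:R.
  move=> vrho; pose g' i := f i + v * (g i - kap * f i).
  have g'1 : power_sum q s g' <= 1 + K * rho ^+ 2 by rewrite -vrho Hd// vrho.
  have lamV : normc (lam^-1%:C%C) = lam^-1 by rewrite normc_real// invr_ge0 ltW.
  have := fmax (fun i => lam^-1%:C%C * g' i).
  rewrite power_sumZ pairing_productZ lamV -/N.
  have -> : lam^-1 `^ q * power_sum q s g' <= 1.
    apply: (@le_trans _ _ (lam^-1 * lam)); last by rewrite mulVf ?gt_eqF.
    apply: ler_pM; rewrite ?powR_ge0 ?power_sum_ge0//.
      by rewrite ge1r_powR ?invr_gt0 ?lam0 ?invf_le1//; lra.
    by apply: (le_trans g'1); exact: expR_ge1Dx.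
  move=> /(_ isT); rewrite exprVn lamN ler_pdivrMl ?expR_gt0// => Fg'.
  rewrite -(ler_pM2r Ff0) Pv normc_prod /pairing_product -big_split /=.
  rewrite [leLHS](_ : _ = pairing_product s r Y m g'); last first.
    rewrite /pairing_product big_seq [RHS]big_seq; apply: eq_bigr => k kr.
    have [->|mk] := posnP (m k); first by rewrite !expr0 normc1 mul1r.
    by rewrite /g' pf// normcM exprMn normcX mulrC.
  by apply: (le_trans Fg'); rewrite mulrCA mulrA.
have := jensen_factor rho0 H; rewrite P0 normc1 mulr1 => J1.
have rb : rho * normc (b k0) <= 2 * expR 1.
  rewrite leNgt; apply/negP => lt; move: J1; apply/negP; rewrite -ltNge.
  apply: (@le_lt_trans _ _ ((2 * expR 1) ^+ m k0)).
    rewrite exprMn -expRM_natl mulr1; apply: ler_wpM2r; first exact: expR_ge0.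
    by rewrite -[leLHS]expr1; apply: ler_weXn2l => //; rewrite ler1n.
  by rewrite ltr_pXn2r ?nnegrE -?lt0n ?mulr_ge0 ?expR_ge0 ?normc_ge0 ?(ltW rho0).
have rh : rho * h <= 4 * expR 1 * a.
  apply: (@le_trans _ _ (rho * (2 * a * normc (b k0)))); first by rewrite ler_pM2l.
  have -> : rho * (2 * a * normc (b k0)) = 2 * a * (rho * normc (b k0)) by ring.
  have -> : 4 * expR 1 * a = 2 * a * (2 * expR 1) by ring.
  by apply: ler_wpM2l => //; rewrite mulr_ge0// ltW.
have : (rho * h) ^+ 2 <= (4 * expR 1 * a) ^+ 2.
  by rewrite ler_sqr ?nnegrE// mulr_ge0 ?mulr_ge0 ?expR_ge0 ?(ltW rho0) ?(ltW a0).
rewrite !exprMn rho2 -[expR 1 ^+ 2]expRM_natl mulr1 => sq_le.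
have KN0 : 0 < K * N%:R by rewrite mulr_gt0.
have -> : (m k0)%:R * h ^+ 2 = (m k0)%:R / (K * N%:R) * h ^+ 2 * (K * N%:R).
  by field; rewrite !gt_eqF.
apply: (le_trans (ler_wpM2r (ltW KN0) sq_le)).
by rewrite le_eqVlt; apply/orP; left; apply/eqP; ring.
Qed.

(** Up to the constant, this is Ball's complex plank theorem, with the unit ball of
    [l_q] in place of that of a Hilbert space. A near-maximizer of the product of
    the [|<y_k, f>| ^ m_k] is the required point: with [m k] proportional to
    [(h k) ^- 2], up to rounding, the bound obtained for each factor no longer
    depends on [k]. *)
Lemma complex_plank : exists2 A : R, 0 < A &
  forall q s r Y G (h : L -> R) (B : R), 2 <= q <= 3 -> 0 < B ->
  (forall k, k \in r -> [/\ 0 < h k, h k <= normc (pairing s (Y k) (G k)) &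
                            power_sum q s (G k) <= 1]) ->
  \sum_(k <- r) (h k) ^- 2 <= B ->
  exists2 f, power_sum q s f <= 1 & forall k, k \in r ->
    1 <= A * B * normc (pairing s (Y k) f) ^+ 2.
Proof.
have [K K1 HK] := tangent_smoothness_exists.
have K0 : 0 < K by rewrite (lt_le_trans ltr01).
exists (32 * K * expR 2) => [|q s r Y G h B q23 B0 H hB].
  by rewrite !mulr_gt0// ?expR_gt0// ltr0n.
have q0 : 0 < q by have /andP[] := q23; lra.
have [r0|[k1 k1r]] : r = [::] \/ exists k, k \in r.
  by case: (r) => [|k r']; [left|right; exists k; rewrite mem_head].
  exists (fun=> 0) => [|k]; last by rewrite r0.
  by rewrite /power_sum big1 ?ler01// => i _; rewrite normc0 powR0 ?gt_eqF.
have sr0 : (0 < size r)%N by case: (r) k1r.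
pose M : R := (size r)%:R / B.
have M0 : 0 < M by rewrite divr_gt0// ltr0n.
pose m k := (Num.truncn (M * (h k) ^- 2)).+1.
have mh k : k \in r -> M <= (m k)%:R * h k ^+ 2.
  move=> kr; have [hk _ _] := H k kr; rewrite -ler_pdivrMr ?exprn_gt0//.
  by rewrite ltW// truncnS_gt.
have mN : (\sum_(k <- r) m k)%:R <= 2 * (M * B).
  rewrite natr_sum; apply: (@le_trans _ _ (\sum_(k <- r) (M * (h k) ^- 2 + 1))).
    rewrite big_seq [leRHS]big_seq; apply: ler_sum => k kr.
    have [hk _ _] := H k kr; rewrite /m -natr1 lerD2r.
    by rewrite truncn_le mulr_ge0 ?(ltW M0)// invr_ge0 exprn_ge0// ltW.
  rewrite big_split /= -mulr_sumr mulr2n mulrDl mul1r; apply: lerD.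
    by rewrite ler_pM2l.
  by rewrite big_const_seq count_predT iter_addr_0 /M divfK ?gt_eqF.
have [f [f1 Ff0 fmax]] : exists f, [/\ power_sum q s f = 1,
    0 < pairing_product s r Y m f & forall g, power_sum q s g <= 1 ->
      pairing_product s r Y m g <= 2 * pairing_product s r Y m f].
  have [|f [f1 F0 fmax]] := @near_maximizer q s r Y m q0.
    apply: (@common_nonvanishing _ _ _ G) => k kr; have [hk hk' _] := H k kr.
    by rewrite -normc_gt0 (lt_le_trans hk).
  have fS : 0 < power_sum q s f.
    apply: (@pairing_neq0_power_sum _ _ (Y k1)); apply: contraTneq F0 => f0.
    by rewrite /pairing_product (big_rem k1)//= f0 normc0 expr0n mul0r ltxx.
  pose c : R := power_sum q s f `^ - q^-1.
  have c0 : 0 < c by rewrite powR_gt0.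
  have c1 : 1 <= c.
    rewrite /c powRN invf_ge1 ?powR_gt0//.
    rewrite [leRHS](_ : 1 = 1 `^ q^-1); last by rewrite powR1.
    by apply: ge0_ler_powR; rewrite ?nnegrE ?invr_ge0 ?(ltW q0) ?(ltW fS).
  exists (fun i => c%:C%C * f i).
  have Fc : pairing_product s r Y m f <=
      pairing_product s r Y m (fun i => c%:C%C * f i).
    rewrite pairing_productZ normc_real ?(ltW c0)//.
    by rewrite ler_peMl ?pairing_product_ge0// exprn_ege1.
  split; first last.
  - move=> g /fmax/le_trans; apply; exact: ler_wpM2l.
  - exact: lt_le_trans Fc.
  - rewrite power_sumZ normc_real ?(ltW c0)// /c -powRrM mulNr mulVf ?gt_eqF//.
    by rewrite powR_inv1 ?(ltW fS)// mulVf ?gt_eqF.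
exists f => [|k kr]; first by rewrite f1.
have [hk hk' Gk] := H k kr.
have := near_maximizer_pairing K1 HK q23 kr (ltn0Sn _) f1 Ff0 fmax Gk.
rewrite -/(m k) => near_bound; rewrite -(ler_pM2l M0) mulr1.
apply: (le_trans (mh k kr)); apply: le_trans (le_trans _ near_bound) _.
  by rewrite ler_wpM2l// ler_sqr ?nnegrE ?normc_ge0 ?(ltW hk).
have -> : M * (32 * K * expR 2 * B * normc (pairing s (Y k) f) ^+ 2) =
  16 * K * expR 2 * (2 * (M * B)) * normc (pairing s (Y k) f) ^+ 2 by ring.
apply: ler_wpM2r; first exact: sqr_ge0.
by apply: ler_wpM2l => //; rewrite !mulr_ge0// ?expR_ge0// ltW.
Qed.

End ComplexPlank.

(** * Out-degrees in a tournament *)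

Section Tournament.
Context {R : realType} {T : eqType}.
Implicit Types (e : rel T) (o : T -> nat) (r : seq T) (s : R).

Definition outdegree e r n := count (fun m => (m != n) && e n m) r.

(** The out-degrees add up to at least the number of pairs of vertices. *)
Lemma tournament_max_outdegree e r : uniq r -> (0 < size r)%N ->
  {in r &, forall m n, m != n -> e m n || e n m} ->
  exists2 k, k \in r & (size r <= (2 * outdegree e r k).+1)%N.
Proof.
move=> ur r0 He; apply: contrapT => H.
have small k : k \in r -> (2 * outdegree e r k + 2 <= size r)%N.
  by move=> kr; rewrite leqNgt; apply/negP => lt; apply: H; exists k => //; lia.
have S2 : (2 * \sum_(n <- r) outdegree e r n + 2 * size r <= size r * size r)%N.
  have -> : (2 * \sum_(n <- r) outdegree e r n + 2 * size r =
             \sum_(n <- r) (2 * outdegree e r n + 2))%N.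
    by rewrite big_split /= big_distrr /= big_const_seq count_predT iter_addn_0 mulnC.
  have -> : (size r * size r = \sum_(n <- r) size r)%N.
    by rewrite big_const_seq count_predT iter_addn_0.
  rewrite [leqLHS]big_seq [leqRHS]big_seq; apply: leq_sum => k kr; exact: small.
have S1 : (\sum_(n <- r) \sum_(m <- r) (m != n) <= 2 * \sum_(n <- r) outdegree e r n)%N.
  have dE : (\sum_(n <- r) outdegree e r n =
             \sum_(n <- r) \sum_(m <- r) ((m != n) && e n m))%N.
    by apply: eq_bigr => n _; rewrite /outdegree -sum1_count big_mkcond;
       apply: eq_bigr => m _; case: (_ && _).
  have dE' : (\sum_(n <- r) outdegree e r n =
              \sum_(n <- r) \sum_(m <- r) ((n != m) && e m n))%N.
    by rewrite dE exchange_big.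
  rewrite mul2n -addnn {1}dE' dE -big_split /=.
  rewrite big_seq [leqRHS]big_seq; apply: leq_sum => n nr; rewrite -big_split /=.
  rewrite big_seq [leqRHS]big_seq; apply: leq_sum => m mr.
  have := He m n mr nr; rewrite [n == m]eq_sym; case: (m == n) => //= /(_ isT).
  by case: (e m n); case: (e n m) => //=.
have S0 : (\sum_(n <- r) \sum_(m <- r) (m != n) + size r = size r * size r)%N.
  have cn n : n \in r -> (\sum_(m <- r) (m != n) + 1 = size r)%N.
    move=> nr; have -> : (\sum_(m <- r) (m != n) = count (predC (pred1 n)) r)%N.
      rewrite -sum1_count [RHS]big_mkcond.
      by apply: eq_bigr => m _ /=; case: (m == n).
    by rewrite -(count_predC (pred1 n) r) count_uniq_mem// nr addnC.
  have -> : (size r * size r = \sum_(n <- r) size r)%N.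
    by rewrite big_const_seq count_predT iter_addn_0.
  rewrite -[X in (_ + X)%N]sum1_size -big_split /= big_seq [RHS]big_seq.
  by apply: eq_bigr => n nr; rewrite cn.
lia.
Qed.

(** Sorted increasingly, the out-degrees of a tournament grow at least linearly,
    since [k] vertices span [k (k - 1) / 2] arcs; hence the [s]-th inverse powers
    of the nonzero ones are summable for [1 < s], uniformly in the size of the tournament. *)
Lemma tournament_sum e o r s : 0 <= s -> uniq r ->
  {in r &, forall m n, m != n -> e m n || e n m} ->
  {in r, forall n, (outdegree e r n <= o n)%N} ->
  \sum_(n <- r | (0 < o n)%N) ((o n)%:R `^ s)^-1 <=
  4 `^ s * \sum_(i < size r) (i.+1%:R `^ s)^-1 :> R.
Proof.
move=> s0; have [n] := ubnP (size r); elim: n r => // n IH r.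
rewrite ltnS => rn ur He Ho; have [r0|r0] := posnP (size r).
  by rewrite r0 big_ord0 mulr0; case: (r) r0 => //; rewrite big_nil.
have [k kr dk] := tournament_max_outdegree ur r0 He.
have sub l : l \in rem k r -> l \in r by exact: mem_rem.
have sz : size r = (size (rem k r)).+1 by rewrite size_rem// prednK.
rewrite (big_rem k)//= sz big_ord_recr /= mulrDr addrC; apply: lerD.
  apply: IH; first by rewrite sz in rn.
  - exact: rem_uniq.
  - by move=> a b /sub ar /sub br; exact: He.
  - move=> l /sub lr; apply: leq_trans (Ho l lr).
    by apply: leq_count_subseq; exact: rem_subseq.
case: ifPn => [ok|_]; last by rewrite mulr_ge0 ?invr_ge0 ?powR_ge0.
rewrite -sz -(invrK (4 `^ s)) -invfM lef_pV2 ?posrE ?powR_gt0 ?ltr0n//; last first.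
  by rewrite mulr_gt0 ?invr_gt0 ?powR_gt0 ?ltr0n.
rewrite mulrC ler_pdivrMr ?powR_gt0// -powRM ?ler0n//.
apply: ge0_ler_powR; rewrite ?nnegrE ?mulr_ge0 ?ler0n//.
rewrite -natrM ler_nat; have := Ho k kr; lia.
Qed.

(** Comparison with the telescoping sum of the differences of [i ^ - (s - 1)]. *)
Lemma riemann_sum_bound (s : R) n : 1 < s ->
  \sum_(i < n) (i.+1%:R `^ s)^-1 <= 1 + (s - 1)^-1.
Proof.
move=> s1; pose t := s - 1; have t0 : 0 < t by rewrite subr_gt0.
suff H : t * \sum_(i < n.+1) (i.+1%:R `^ s)^-1 <= t + 1 - (n.+1%:R `^ t)^-1 :> R.
  apply: (@le_trans _ _ (\sum_(i < n.+1) (i.+1%:R `^ s)^-1)).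
    by rewrite big_ord_recr /= lerDl invr_ge0 powR_ge0.
  rewrite -(ler_pM2l t0); apply: (le_trans H).
  rewrite mulrDr mulr1 mulfV ?gt_eqF// gerBl invr_ge0; exact: powR_ge0.
elim: n => [|n IH]; first by rewrite big_ord1 /= !powR1 invr1 mulr1 addrK.
rewrite big_ord_recr /= mulrDr; apply: (le_trans (lerD IH (lexx _))).
rewrite -addrA lerD2l -lerBrDr -opprD lerNr opprK -lerBrDr.
set x : R := n.+1%:R; set y : R := n.+2%:R.
have x0 : 0 < x by rewrite ltr0n.
have y0 : 0 < y by rewrite ltr0n.
have yx : y = x + 1 by rewrite /y /x natr1.
have -> : (y `^ s)^-1 = (y `^ t)^-1 * y^-1.
  by rewrite -invfM mulrC mulr_powRB1 ?(ltW y0)// (lt_trans ltr01).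
rewrite lerBrDr.
have -> : (x `^ t)^-1 = (y `^ t)^-1 * expR (t * (ln y - ln x)).
  rewrite -!powRN /powR !gt_eqF// -expRD; congr expR; ring.
have -> : (y `^ t)^-1 + t * ((y `^ t)^-1 * y^-1) = (y `^ t)^-1 * (1 + t * y^-1) by ring.
apply: ler_wpM2l; first by rewrite invr_ge0 powR_ge0.
apply: le_trans (expR_ge1Dx _); rewrite lerD2l; apply: ler_wpM2l; first exact: ltW.
have y1 : 1 < y by rewrite ltr1n.
have := @le_ln1Dx R (- y^-1); rewrite ltrN2 invf_lt1// => /(_ y1).
have yn0 : y != 0 by rewrite gt_eqF.
have -> : 1 - y^-1 = x / y.
  by apply: (mulIf yn0); rewrite mulrBl mulVf// divfK// yx; ring.
by rewrite ln_div ?posrE// lerNr opprB.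
Qed.

End Tournament.

(** * Norms and coordinates in l_p *)

Section LpBasics.
Context {R : realType} {p : R} {p1 : 1 <= p}.
Local Notation C := R[i].
Local Notation E := (lp p1).
Implicit Types (x y z : E) (a : C) (j : int).

Let p0 : 0 < p. Proof. exact: lt_le_trans p1. Qed.

(** The real-valued norm; the norm of the normed module takes values in [C]. *)
Definition nrm x : R := lp_norm p x.

Lemma normr_lp x : `|x| = (nrm x)%:C%C.
Proof. by []. Qed.

Lemma nrm_ge0 x : 0 <= nrm x.
Proof. exact: powR_ge0. Qed.

Lemma nrmD x y : nrm (x + y) <= nrm x + nrm y.
Proof. by have := ler_normD x y; rewrite !normr_lp -rmorphD lecR. Qed.

Lemma nrmZ a x : nrm (a *: x) = normc a * nrm x.
Proof. by rewrite /nrm -(lp_normZ a (lp_funP x)). Qed.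

Lemma nrm0 : nrm 0 = 0.
Proof. by apply: complexI; rewrite -normr_lp normr0. Qed.

Lemma nrmN x : nrm (- x) = nrm x.
Proof. by rewrite -scaleN1r nrmZ normcN normc1 mul1r. Qed.

Lemma nrmB x y : nrm (x - y) = nrm (y - x).
Proof. by rewrite -nrmN opprB. Qed.

Lemma nrm_sum (I : Type) (s : seq I) (F : I -> E) :
  nrm (\sum_(i <- s) F i) <= \sum_(i <- s) nrm (F i).
Proof.
elim: s => [|i s IH]; first by rewrite !big_nil nrm0.
by rewrite !big_cons (le_trans (nrmD _ _))// lerD2l.
Qed.

Lemma lp_add x y j : lp_fun (x + y) j = x j + y j. Proof. by []. Qed.
Lemma lp_scale a x j : lp_fun (a *: x) j = a * x j. Proof. by []. Qed.

Lemma lp_sum_apply (I : Type) (s : seq I) (F : I -> E) j :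
  lp_fun (\sum_(i <- s) F i) j = \sum_(i <- s) F i j.
Proof. by elim: s => [|i s IH]; rewrite ?big_nil// !big_cons lp_add IH. Qed.

Lemma lp_ext x y : (forall j, x j = y j) -> x = y.
Proof. by move=> xy; apply: val_inj; apply/funext. Qed.

Lemma esum_seq_le (f : int -> R) (s : seq int) : (forall j, 0 <= f j) -> uniq s ->
  ((\sum_(j <- s) f j)%:E <= \esum_(n in [set: int]) (f n)%:E)%E.
Proof.
move=> f0 us; rewrite -sumEFin (fsbig_seq _ _ us).
by apply: esum_ge; exists [set` s] => //; split => //; exact: finite_seq.
Qed.

Lemma esum_le_seq (f : int -> R) (B : R) : (forall j, 0 <= f j) ->
  (forall s : seq int, uniq s -> \sum_(j <- s) f j <= B) ->
  (\esum_(n in [set: int]) (f n)%:E <= B%:E)%E.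
Proof.
move=> f0 H; apply: ge_ereal_sup => _ [A [finA _]] <-.
by rewrite fsbig_finite//= sumEFin lee_fin H// fset_uniq.
Qed.

Lemma lp_seq_sum_le x (s : seq int) : uniq s ->
  \sum_(j <- s) normc (x j) `^ p <= nrm x `^ p.
Proof.
move=> us; rewrite -lee_fin -lp_sumE; last exact: lp_funP.
by apply: (esum_seq_le (f := fun j => normc (x j) `^ p)) => // j; exact: powR_ge0.
Qed.

Lemma normc_coord_le x j : normc (x j) <= nrm x.
Proof.
have := @lp_seq_sum_le x [:: j] isT; rewrite big_seq1 => H.
rewrite leNgt; apply/negP => lt; move: H; apply/negP; rewrite -ltNge.
by rewrite gt0_ltr_powR ?nnegrE ?nrm_ge0 ?normc_ge0.
Qed.

(** A sequence belongs to [l_p] as soon as its finite sums are bounded; this takes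
    the place of completeness when a vector is built as the sum of a series. *)
Lemma lp_of_seq_sums (f : int -> C) (B : R) : 0 <= B ->
  (forall s, uniq s -> \sum_(j <- s) normc (f j) `^ p <= B `^ p) ->
  exists2 x : E, (x : int -> C) = f & nrm x <= B.
Proof.
move=> B0 H; have [|fp fB] := @lp_norm_le R p p1 f B B0; last by exists (Lp fp).
by apply: esum_le_seq => // j; exact: powR_ge0.
Qed.

Lemma nrm_le_seq_sums x (B : R) : 0 <= B ->
  (forall s, uniq s -> \sum_(j <- s) normc (x j) `^ p <= B `^ p) -> nrm x <= B.
Proof.
move=> B0 H; have [y yx yB] := lp_of_seq_sums B0 H.
by rewrite (_ : x = y)//; apply: val_inj.
Qed.

Lemma basisE n j : lp_basis p1 n j = (j == n)%:R. Proof. by []. Qed.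

Lemma basis_diag n : lp_basis p1 n n = 1 :> C. Proof. by rewrite basisE eqxx. Qed.

Lemma basis_off n j : j != n -> lp_basis p1 n j = 0 :> C.
Proof. by rewrite basisE => /negbTE ->. Qed.

Lemma nrm_basis n : nrm (lp_basis p1 n) <= 1.
Proof.
apply: nrm_le_seq_sums => // s us; rewrite powR1.
have [ns|ns] := boolP (n \in s); last first.
  rewrite big_seq big1 ?ler01// => j js; rewrite basisE.
  by case: eqVneq js ns => [-> ->//|_ _ _]; rewrite normc0 powR0 ?gt_eqF.
rewrite (big_rem n)//= /unit_seq eqxx normc1 powR1 big_seq big1 ?addr0// => j.
rewrite mem_rem_uniq// inE => /andP[/negbTE -> _].
by rewrite normc0 powR0 ?gt_eqF.
Qed.

(** Finitely supported vectors are coded by lists of (index, coefficient) pairs, with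
    repetitions allowed, so that concatenation codes the sum. *)
Definition comb (s : seq (int * C)) : E := \sum_(b <- s) b.2 *: lp_basis p1 b.1.

Lemma comb_cat s t : comb (s ++ t) = comb s + comb t.
Proof. by rewrite /comb big_cat. Qed.

Lemma nrm_comb_le s : nrm (comb s) <= \sum_(b <- s) normc b.2.
Proof.
apply: (le_trans (nrm_sum _ _)); apply: ler_sum => b _.
by rewrite nrmZ ler_piMr ?normc_ge0// nrm_basis.
Qed.

Lemma comb_coord s j : comb s j = \sum_(b <- s) (if b.1 == j then b.2 else 0).
Proof.
rewrite /comb lp_sum_apply; apply: eq_bigr => b _.
by rewrite lp_scale basisE eq_sym; case: eqP; rewrite ?mulr1 ?mulr0.
Qed.

Lemma comb_coord_eq0 s j : (forall b, b \in s -> b.1 != j) -> comb s j = 0.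
Proof.
by move=> H; rewrite comb_coord big_seq big1// => b /H /negbTE ->.
Qed.

Lemma comb_graph (f : int -> C) (s : seq int) j : uniq s ->
  comb [seq (i, f i) | i <- s] j = if j \in s then f j else 0.
Proof.
move=> us; rewrite comb_coord big_map /=; case: ifPn => js.
  rewrite (big_rem j)//= eqxx big_seq big1 ?addr0// => i.
  by rewrite mem_rem_uniq// inE => /andP[/negbTE ->].
by rewrite big_seq big1// => i si; case: eqP => // ij; rewrite -ij si in js.
Qed.

Lemma comb_dense x (e : R) : 0 < e -> exists s, nrm (x - comb s) < e.
Proof.
move=> e0; have h0 : 0 < e / 2 by rewrite divr_gt0.
have xfin := lp_sumE (lp_funP x).
have : (lp_sum p x - ((e / 2) `^ p)%:E < lp_sum p x)%E.
  by rewrite xfin -EFinB lte_fin ltrBlDr ltrDl powR_gt0.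
move=> /ereal_sup_gt[_ [A [finA _] <-]].
rewrite fsbig_finite//= sumEFin xfin -EFinB lte_fin => Hs.
set s : seq int := fset_set A in Hs.
have us : uniq s by exact: fset_uniq.
exists [seq (i, x i) | i <- s]; apply: (@le_lt_trans _ _ (e / 2)); last by lra.
apply: nrm_le_seq_sums => [|t ut]; first exact: ltW.
have := @lp_seq_sum_le x (s ++ [seq j <- t | j \notin s]).
rewrite cat_uniq us filter_uniq// andbT => /(_ _)/=; rewrite big_cat big_filter => K.
have {}K := K ltac:(by apply/hasPn => j; rewrite mem_filter => /andP[]).
apply: (@le_trans _ _ (\sum_(j <- t | j \notin s) normc (x j) `^ p)); last first.
  by rewrite /nrm /= in K; move: Hs K => /= Hs K; lra.
rewrite [leRHS]big_mkcond; apply: ler_sum => j _.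
rewrite -[leLHS]/(normc (x j - comb [seq (i, x i) | i <- s] j) `^ p) comb_graph//.
by case: (j \in s) => /=; rewrite ?subr0// subrr normc0 powR0 ?gt_eqF.
Qed.

End LpBasics.

(** * Weakly dense sets and bounded functionals *)

Section WeakTopology.
Context {R : realType}.
Local Notation C := R[i].

Lemma weak_continuous (V : normedModType C) (f : {linear V -> C^o}) :
  continuous f -> continuous (f : weak_topology V -> C^o).
Proof.
move=> fc x.
pose i : {f : {linear V -> C^o} | continuous f} := exist _ f fc.
have idc : (id : weak_topology V -> weak_topology V) @ x --> x by exact: cvg_id.
have := (@cvg_sup V _ (fun f : {f : {linear V -> C^o} | continuous f} =>
    Topological.class (initial_topology (sval f))) _ x _).1 idc i.
move=> h B fB; apply: (h _ (f @^-1` B)).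
  exact: (@fmap_filter _ _ id _ (@nbhs_filter (weak_topology V) x)).
exact: (@initial_continuous V C^o f x B fB).
Qed.

Lemma open_normc_lt (d : R) : open [set z : C^o | normc z < d].
Proof.
rewrite openE => z /= zd; apply/nbhs_ballP; exists (d - normc z)%:C%C => /=.
  by rewrite ltcR subr_gt0.
move=> t; rewrite -ball_normE /= normr_normc ltcR => zt.
rewrite -(subrK z t) (le_lt_trans (le_normcD _ _))// -ltrBrDr.
by rewrite normcB.
Qed.

Lemma open_normc_gt (d : R) : open [set z : C^o | d < normc z].
Proof.
rewrite openE => z /= zd; apply/nbhs_ballP; exists (normc z - d)%:C%C => /=.
  by rewrite ltcR subr_gt0.
move=> t; rewrite -ball_normE /= normr_normc ltcR => zt.
have : normc z <= normc (z - t) + normc t.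
  by rewrite -{1}(subrK t z) le_normcD.
lra.
Qed.

Lemma weakly_dense_meets (V : normedModType C) (A : set V)
    (f g : {linear V -> C^o}) (B D : set C^o) :
  continuous f -> continuous g -> open B -> open D -> weakly_dense A ->
  (exists y, B (f y) /\ D (g y)) -> exists2 y, A y & B (f y) /\ D (g y).
Proof.
move=> fc gc oB oD dA [y [By Dy]].
pose O : set (weak_topology V) := (f @^-1` B) `&` (g @^-1` D).
have [||z [[Bz Dz] Az]] := dA O.
- by exists y.
- apply: openI.
    exact: ((@continuousP _ _ (f : weak_topology V -> C^o)).1 (weak_continuous fc) B oB).
  exact: ((@continuousP _ _ (g : weak_topology V -> C^o)).1 (weak_continuous gc) D oD).
by exists z.
Qed.

End WeakTopology.

Section BoundedFunctionals.
Context {R : realType} {p : R} {p1 : 1 <= p}.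
Local Notation C := R[i].
Local Notation E := (lp p1).

Lemma bounded_functional (F : E -> C) (B : R) :
  (forall a x y, F (a *: x + y) = a * F x + F y) ->
  (forall y, normc (F y) <= B * nrm y) ->
  exists2 f : {linear E -> C^o}, continuous f & forall y, f y = F y.
Proof.
move=> Flin FB.
have FlinP : linear (F : E -> C^o) by move=> a x y; exact: Flin.
pose f : {linear E -> C^o} := HB.pack (F : E -> C^o)
  (GRing.isLinear.Build _ _ _ _ (F : E -> C^o) FlinP).
exists f => //; apply/linear_bounded_continuous/linear_boundedP.
exists (`|B|)%:C%C; split; first by apply/complex_realP; exists `|B|.
move=> r Br y; have r0 : 0 <= r by rewrite (le_trans _ (ltW Br))// lecR.
apply: (@le_trans _ _ (`|B|%:C%C * `|y|)); last by rewrite ler_wpM2r// ltW.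
rewrite !normr_normc normr_lp -rmorphM lecR (le_trans (FB y))//.
by rewrite ler_wpM2r ?nrm_ge0// ler_norm.
Qed.

Lemma coord_functional (j : int) :
  exists2 f : {linear E -> C^o}, continuous f & forall y, f y = y j.
Proof.
apply: (@bounded_functional (fun y => y j) 1) => // y.
by rewrite mul1r normc_coord_le.
Qed.

Lemma linear_bound (T : {linear E -> E}) : continuous T ->
  exists2 M : R, 1 <= M & forall y, nrm (T y) <= M * nrm y.
Proof.
move=> /linear_bounded_continuous/linear_boundedP/pinfty_ex_gt0[r r0 H].
exists (1 + normc r) => [|y]; first by rewrite lerDl normc_ge0.
have rE : r = (normc r)%:C%C by rewrite -normr_normc ger0_norm// ltW.
have := H y; rewrite !normr_lp {1}rE -rmorphM lecR => /le_trans; apply.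
by apply: ler_wpM2r; rewrite ?nrm_ge0 ?lerDr ?ler01.
Qed.

End BoundedFunctionals.

(** * Construction of a universal vector *)

Section UniversalVector.
Context {R : realType} {p : R} {p1 : 1 <= p}.
Local Notation C := R[i].
Local Notation E := (lp p1).
Local Notation comb := (@comb R p p1).

Lemma injective_unbounded (g : nat -> nat) N : injective g -> exists d, (N <= g d)%N.
Proof.
move=> gi; apply: contrapT => H.
have : (size (map g (iota 0 N.+1)) <= size (iota 0 N))%N.
  apply: uniq_leq_size; first by rewrite map_inj_uniq ?iota_uniq.
  move=> _ /mapP[d _ ->]; rewrite mem_iota add0n /= ltnNge.
  by apply/negP => Nd; apply: H; exists d.
by rewrite size_map !size_iota ltnn.
Qed.

Definition rat_complex (c : rat * rat) : C := (ratr c.1 +i* ratr c.2)%C.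

Definition rat_seq (s : seq (int * (rat * rat))) : seq (int * C) :=
  [seq (b.1, rat_complex b.2) | b <- s].

Lemma rat_complex_dense (z : C) (e : R) : 0 < e ->
  exists c, normc (z - rat_complex c) < e.
Proof.
case: z => a b e0; have e20 : 0 < e / 2 by rewrite divr_gt0.
have [q1 /andP[aq1 qa1]] : exists q : rat, a - e / 2 < ratr q < a + e / 2.
  by have [|q] := @rat_in_itvoo R (a - e / 2) (a + e / 2); [lra|rewrite in_itv; exists q].
have [q2 /andP[bq2 qb2]] : exists q : rat, b - e / 2 < ratr q < b + e / 2.
  by have [|q] := @rat_in_itvoo R (b - e / 2) (b + e / 2); [lra|rewrite in_itv; exists q].
exists (q1, q2).
have -> : (a +i* b)%C - rat_complex (q1, q2) =
    (a - ratr q1)%:C%C + (0 +i* (b - ratr q2))%C.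
  by apply/eqP; rewrite eq_complex /= addr0 add0r !eqxx.
apply: (le_lt_trans (le_normcD _ _)).
rewrite /normc /= !expr0n /= addr0 add0r !sqrtr_sqr.
have h1 : `|a - ratr q1| < e / 2 by rewrite ltr_norml; lra.
have h2 : `|b - ratr q2| < e / 2 by rewrite ltr_norml; lra.
lra.
Qed.

Lemma rat_seq_dense (s : seq (int * C)) (e : R) : 0 < e ->
  exists t, nrm (comb s - comb (rat_seq t)) < e.
Proof.
elim: s e => [|b s IH] e e0.
  by exists [::]; rewrite /comb !big_nil subrr nrm0.
have e20 : 0 < e / 2 by rewrite divr_gt0.
have [t Ht] := IH _ e20; have [c Hc] := rat_complex_dense b.2 e20.
exists ((b.1, c) :: t); rewrite /comb /= !big_cons /=.
rewrite opprD addrACA -scalerBl (le_lt_trans (nrmD _ _))//.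
rewrite [e]splitr; apply: ltr_leD; last exact: ltW.
rewrite nrmZ; apply: le_lt_trans Hc.
by rewrite ler_piMr ?normc_ge0 ?nrm_basis.
Qed.

Lemma dense_enumeration : exists u : nat -> seq (int * C),
  forall (y : E) (e : R) N, 0 < e -> exists2 i, (N <= i)%N & nrm (comb (u i) - y) < e.
Proof.
(* the second component of the code is a dummy: it makes every vector occur at
   infinitely many indices *)
pose dec (i : nat) : seq (int * C) :=
  if choice.unpickle i : option (seq (int * (rat * rat)) * nat) is Some c
  then rat_seq c.1 else [::].
exists dec => y e N e0; have e20 : 0 < e / 2 by rewrite divr_gt0.
have [s Hs] := comb_dense y e20; have [t Ht] := rat_seq_dense s e20.
have [|d Nd] := @injective_unbounded (fun d => choice.pickle (t, d)) N.
  by move=> d d' /(pcan_inj choice.pickleK)[].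
exists (choice.pickle (t, d)) => //.
have -> : dec (choice.pickle (t, d)) = rat_seq t by rewrite /dec choice.pickleK.
rewrite nrmB.
rewrite -(subrK (comb s) y) -addrA (le_lt_trans (nrmD _ _))// [e]splitr.
by apply: ltrD; [exact: Hs|exact: Ht].
Qed.

Context (T : {linear E -> E}) (M : R).
Hypotheses (M1 : 1 <= M) (TM : forall y, nrm (T y) <= M * nrm y).

Lemma nrm_iter n y : nrm (iter n T y) <= M ^+ n * nrm y.
Proof.
elim: n => [|n IH]; first by rewrite expr0 mul1r.
rewrite iterS exprS -mulrA; apply: (le_trans (TM _)).
by apply: ler_wpM2l; [exact: le_trans M1|exact: IH].
Qed.

Lemma iterD_lin n : {morph iter n T : x y / x + y}.
Proof. by elim: n => // n IH x y; rewrite !iterS IH linearD. Qed.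

Lemma iterZ_lin n a y : iter n T (a *: y) = a *: iter n T y.
Proof. by elim: n => // n IH; rewrite !iterS IH linearZ. Qed.

Lemma iter_sum (I : Type) (s : seq I) (F : I -> E) n :
  iter n T (\sum_(i <- s) F i) = \sum_(i <- s) iter n T (F i).
Proof. by elim: n => // n IH; rewrite iterS IH linear_sum. Qed.

Variable L : set C.

(** What is needed to append one more block [v] to a partial sum [X]: [l T^n]
    sends [v] to the target [u] while the block is small, far to the right, and [X]
    is almost annihilated. *)
Definition right_block (u X v : seq (int * C)) (d : R) (s : int) n (l : C) :=
  [/\ L l, l *: iter n T (comb v) = comb u, nrm (comb v) < d,
      nrm (l *: iter n T (comb X)) < d & forall b, b \in v -> s < b.1].

(** The vector is a series of blocks whose supports escape to the right, so that
    each coordinate is eventually constant along the partial sums: it is defined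
    coordinatewise, and every norm estimate is inherited from a partial sum. The
    number [c] bounds all the [|l| M^n] used so far, so that blocks smaller than
    [2 ^- i.+1 / c] cannot spoil the earlier approximations. *)
Lemma universal_vector :
  (forall u X (d : R) s, 0 < d -> exists n l v, right_block u X v d s n l) ->
  exists x : E, forall (y : E) (e : R), 0 < e ->
    exists n l, L l /\ nrm (l *: iter n T x - y) < e.
Proof.
move=> H; have [u Hu] := dense_enumeration.
pose arg := (seq (int * C) * seq (int * C) * R * int)%type.
have /choice[f Hf] : forall a : arg, exists r : nat * C * seq (int * C),
    0 < a.1.2 -> right_block a.1.1.1 a.1.1.2 r.2 a.1.2 a.2 r.1.1 r.1.2.
  move=> [[[u0 X0] d0] s0] /=; have [d0p|d0n] := ltP 0 d0; last first.
    by exists (0%N, 0, [::]).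
  by have [n [l [v Hv]]] := H u0 X0 d0 s0 d0p; exists (n, l, v).
pose h i : R := 2 ^- i.
have h0 i : 0 < h i by rewrite /h invr_gt0 exprn_gt0.
have hS i : h i = h i.+1 + h i.+1.
  by rewrite /h exprS invfM; field.
have halve (a b : R) : b + (a - (b + b)) = a - b by ring.
pose call i (st : seq (int * C) * R) := f (u i, st.1, h i.+1 / st.2, i%:Z).
pose step i st := ((call i st).2 ++ st.1,
  st.2 + normc (call i st).1.2 * M ^+ (call i st).1.1).
pose st := fix st i := if i is j.+1 then step j (st j) else ([::], 1 : R).
pose X i := (st i).1; pose c i := (st i).2.
pose n_ i := (call i (st i)).1.1; pose l_ i := (call i (st i)).1.2.
pose v_ i := (call i (st i)).2.
have X0 : comb (X 0%N) = 0 by rewrite /comb big_nil.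
have XS i : comb (X i.+1) = comb (v_ i) + comb (X i) by rewrite -comb_cat.
have cS i : c i.+1 = c i + normc (l_ i) * M ^+ n_ i by [].
have lM0 i : 0 <= normc (l_ i) * M ^+ n_ i.
  by rewrite mulr_ge0 ?normc_ge0 ?exprn_ge0// (le_trans ler01).
have c1 i : 1 <= c i.
  by elim: i => // i IH; rewrite cS (le_trans IH)// lerDl.
have c0 i : 0 < c i by rewrite (lt_le_trans ltr01).
have cmono i j : (i <= j)%N -> c i <= c j.
  move=> /subnK <-; elim: (j - i)%N => [|k IH]; first by [].
  by rewrite addSn cS (le_trans IH)// lerDl.
have blk i : right_block (u i) (X i) (v_ i) (h i.+1 / c i) i%:Z (n_ i) (l_ i).
  by apply: (Hf (u i, X i, h i.+1 / c i, i%:Z)); rewrite /= divr_gt0.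
have tail i N : (i <= N)%N -> nrm (comb (X N) - comb (X i)) <= (h i - h N) / c i.
  move=> /subnK <-; elim: (N - i)%N => [|k IH].
    by rewrite add0n !subrr mul0r nrm0.
  rewrite addSn XS -addrA (le_trans (nrmD _ _))//.
  have [_ _ vs _ _] := blk (k + i)%N.
  apply: (le_trans (lerD (ltW vs) IH)).
  apply: (@le_trans _ _ (h (k + i).+1 / c i + (h i - h (k + i)) / c i)).
    rewrite lerD2r ler_pM2l// lef_pV2 ?posrE//; apply: cmono; exact: leq_addl.
  rewrite -mulrDl ler_pM2r ?invr_gt0; last exact: c0.
  by rewrite (hS (k + i)%N) halve.
have Xconst j i : (`|j| <= i)%N -> comb (X i) j = comb (X `|j|%N) j.
  move=> /subnK <-; elim: (i - `|j|)%N => [//|k IH].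
  rewrite addSn XS lp_add IH comb_coord_eq0 ?add0r// => b bv.
  have [_ _ _ _ /(_ b bv) sb] := blk (k + `|j|)%N.
  by apply: contraTneq sb => ->; rewrite -leNgt; lia.
have common (s : seq int) : exists N, forall j, j \in s -> (`|j| <= N)%N.
  exists (\sum_(j <- s) `|j|)%N => j js; rewrite (big_rem j)//=; exact: leq_addr.
have hc i N : (h i - h N) / c i <= h i / c i.
  by rewrite ler_pM2r ?invr_gt0// gerBl ltW.
have hc0 i : 0 <= h i / c i by exact: divr_ge0 (ltW (h0 i)) (ltW (c0 i)).
have [x xE _] : exists2 x : E, (x : int -> C) = (fun j => comb (X `|j|%N) j) &
    nrm x <= h 0 / c 0%N.
  apply: lp_of_seq_sums; first exact: hc0.
  move=> s us; have [N HN] := common s.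
  apply: (@le_trans _ _ (nrm (comb (X N)) `^ p)); last first.
    apply: ge0_ler_powR; first exact: le_trans p1.
    - exact: nrm_ge0.
    - exact: hc0.
    have := tail 0%N N (leq0n _); rewrite X0 subr0 => /le_trans; apply; exact: hc.
  apply: le_trans (lp_seq_sum_le _ us); rewrite big_seq [leRHS]big_seq.
  by apply: ler_sum => j /HN js; rewrite Xconst.
have xX i : nrm (x - comb (X i)) <= h i / c i.
  apply: nrm_le_seq_sums; first exact: hc0.
  move=> s us; have [N HN] := common s.
  apply: (@le_trans _ _ (nrm (comb (X (N + i)%N) - comb (X i)) `^ p)); last first.
    apply: ge0_ler_powR; first exact: le_trans p1.
    - exact: nrm_ge0.
    - exact: hc0.
    exact: le_trans (tail _ _ (leq_addl _ _)) (hc _ _).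
  apply: le_trans (lp_seq_sum_le _ us); rewrite big_seq [leRHS]big_seq.
  apply: ler_sum => j /HN js.
  rewrite -[leLHS]/(normc (x j - comb (X i) j) `^ p).
  rewrite -[leRHS]/(normc (comb (X (N + i)%N) j - comb (X i) j) `^ p).
  by rewrite xE (Xconst j (N + i)%N)// (leq_trans js)// leq_addr.
have approx i : nrm (l_ i *: iter (n_ i) T x - comb (u i)) <= h i.
  have [_ lv _ lX _] := blk i.
  have -> : l_ i *: iter (n_ i) T x - comb (u i) =
      l_ i *: iter (n_ i) T (x - comb (X i.+1)) + l_ i *: iter (n_ i) T (comb (X i)).
    rewrite -{1}(subrK (comb (X i.+1)) x) iterD_lin scalerDr -addrA; congr (_ + _).
    by rewrite XS iterD_lin scalerDr lv addrAC subrr add0r.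
  apply: (le_trans (nrmD _ _)); rewrite (hS i); apply: lerD; last first.
    by apply: (le_trans (ltW lX)); rewrite ler_pdivrMr// ler_peMr// ltW.
  rewrite nrmZ; apply: (@le_trans _ _ (c i.+1 * (h i.+1 / c i.+1))); last first.
    by rewrite mulrC divfK ?gt_eqF.
  apply: (@le_trans _ _ (normc (l_ i) * (M ^+ n_ i * nrm (x - comb (X i.+1))))).
    by rewrite ler_wpM2l ?normc_ge0// nrm_iter.
  rewrite [leLHS]mulrA; apply: ler_pM; [exact: lM0|exact: nrm_ge0| |exact: xX].
  by rewrite [leRHS]cS lerDr ltW.
exists x => y e e0; have e20 : 0 < e / 2 by rewrite divr_gt0.
have [N HN] : exists N, forall i, (N <= i)%N -> h i < e / 2.
  exists (Num.truncn (e / 2)^-1) => i Ni.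
  rewrite /h -[ltRHS]invrK ltf_pV2 ?posrE ?invr_gt0 ?exprn_gt0//.
  rewrite (lt_le_trans (truncnS_gt _))//.
  apply: (@le_trans _ _ i.+1%:R); first by rewrite ler_nat ltnS.
  by rewrite -natrX ler_nat ltn_expl.
have [i Ni ui] := Hu y (e / 2) N e20.
exists (n_ i), (l_ i); split; first by have [] := blk i.
rewrite -(subrK (comb (u i)) (l_ i *: iter (n_ i) T x)) -addrA.
apply: (le_lt_trans (nrmD _ _)); rewrite [ltRHS]splitr; apply: ltrD; last exact: ui.
exact: le_lt_trans (approx i) (HN _ Ni).
Qed.

End UniversalVector.

(** * Iterates of a weighted shift *)

Lemma eq_sub_absz (x : int) (m : nat) :
  (`|x| <= m)%N -> x = m%:Z - (`|m%:Z - x|%N)%:Z.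
Proof.
move=> xm; have x_le : x <= m%:Z by lia.
by rewrite gez0_abs ?subr_ge0//; ring.
Qed.

Lemma lt_add_of_absz (x s : int) (m n : nat) :
  (`|x| <= m)%N -> (m + `|s| + 1 <= n)%N -> s < x + n%:Z.
Proof.
move=> xm mn; have mx : - m%:Z <= x by lia.
lia.
Qed.

Section Shift.
Context {R : realType} {p : R} {p1 : 1 <= p}.
Local Notation C := R[i].
Local Notation E := (lp p1).
Local Notation comb := (@comb R p p1).
Context (w : int -> C) (T : {linear E -> E}).
Hypothesis T_shift : is_bilateral_shift w T.

Lemma shift_bound : exists2 M : R, 1 <= M &
  (forall y, nrm (T y) <= M * nrm y) /\ (forall n, normc (w n) <= M).
Proof.
have [_ [W wW] Tc _] := T_shift.
have [M M1 TM] := linear_bound Tc.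
exists (M + normc W); first by rewrite (le_trans M1)// lerDl normc_ge0.
split=> [y|n].
  by rewrite (le_trans (TM y))// ler_wpM2r ?nrm_ge0// lerDl normc_ge0.
have := wW n; rewrite normr_normc => nW.
have W0 : 0 <= W by apply: le_trans nW; rewrite lecR normc_ge0.
rewrite -(ger0_norm W0) normr_normc lecR in nW.
by rewrite (le_trans nW)// lerDr (le_trans ler01).
Qed.

(** Both sides are continuous in [y] and agree on finitely supported vectors. *)
Lemma shift_coord y j : T y j = w (j + 1) * y (j + 1).
Proof.
have [M M1 [TM wM]] := shift_bound; have M0 : 0 < M by rewrite (lt_le_trans ltr01).
apply/eqP; rewrite -subr_eq0 -normc_eq0 eq_le normc_ge0 andbT.
apply/ler_addgt0Pr => e e0; rewrite add0r.
have e20 : 0 < e / (2 * M) by rewrite divr_gt0// mulr_gt0.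
have [s Hs] := comb_dense y e20; set z := y - comb s in Hs.
have yE : y = comb s + z by rewrite /z addrC subrK.
have Ts : T (comb s) j = w (j + 1) * comb s (j + 1).
  have [_ _ _ Te] := T_shift.
  rewrite comb_coord /comb linear_sum lp_sum_apply mulr_sumr; apply: eq_bigr => b _.
  rewrite linearZ lp_scale Te lp_scale basisE -subr_eq opprK.
  rewrite [_ == b.1]eq_sym; case: eqP => [->|_]; rewrite /= ?mulr1n ?mulr0n; ring.
have -> : T y j - w (j + 1) * y (j + 1) = T z j - w (j + 1) * z (j + 1).
  by rewrite {1 2}yE linearD !lp_add Ts; ring.
apply: (le_trans (le_normcD _ _)); rewrite normcN normcM.
apply: (@le_trans _ _ (M * nrm z + M * nrm z)).
  apply: lerD; first by rewrite (le_trans (normc_coord_le _ _)).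
  by apply: ler_pM; rewrite ?normc_ge0 ?normc_coord_le.
rewrite -mulrDl -mulr2n -[M *+ 2]mulr_natl mulrC -ler_pdivlMr ?mulr_gt0//.
exact: ltW.
Qed.

(** The factor by which [T^n] carries the coordinate [j + n] to the coordinate [j]. *)
Definition wprod (j : int) (n : nat) : C := \prod_(i < n) w (j + i.+1%:Z).

Lemma wprod0 j : wprod j 0 = 1.
Proof. by rewrite /wprod big_ord0. Qed.

Lemma wprodD j m n : wprod j (m + n) = wprod j m * wprod (j + m%:Z) n.
Proof.
rewrite /wprod big_split_ord; congr (_ * _); apply: eq_bigr => i _.
by congr w; rewrite /= -addnS PoszD addrA.
Qed.

Lemma wprod_neq0 j n : wprod j n != 0.
Proof. by apply/prodf_neq0 => i _; have [] := T_shift. Qed.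

Lemma normc_wprod_gt0 j n : 0 < normc (wprod j n).
Proof. by rewrite normc_gt0 wprod_neq0. Qed.

Lemma normc_wprod_le (M : R) j n :
  (forall n, normc (w n) <= M) -> normc (wprod j n) <= M ^+ n.
Proof.
move=> wM; have -> : M ^+ n = \prod_(i < n) M by rewrite prodr_const card_ord.
rewrite normc_prod.
by apply: ler_prod => i _; rewrite normc_ge0 wM.
Qed.

Lemma iter_coord n y j : iter n T y j = wprod j n * y (j + n%:Z).
Proof.
elim: n j => [|n IH] j; first by rewrite wprod0 mul1r addr0.
rewrite iterS shift_coord IH mulrA -[in RHS]add1n wprodD.
by rewrite /wprod big_ord1 -addrA PoszD.
Qed.

Lemma iter_basis n j : iter n T (lp_basis p1 j) =
  wprod (j - n%:Z) n *: lp_basis p1 (j - n%:Z).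
Proof.
apply: lp_ext => i; rewrite iter_coord lp_scale !basisE.
rewrite -subr_eq opprK; case: eqP => [<-|_]; first by rewrite addrK.
by rewrite !mulr0.
Qed.

(** One index [k] controls every basis vector to its left, because moving from
    [j] to [k] changes [n]-fold products by factors bounded in terms of [k - j]. *)
Lemma wprod_shift_le (M : R) (k : int) n g :
  (forall n, normc (w n) <= M) ->
  normc (wprod (k - g%:Z - n%:Z) n) <=
    normc (wprod (k - n%:Z) n) * (M ^+ g / normc (wprod (k - g%:Z) g)) /\
  (normc (wprod (k - g%:Z) n))^-1 <=
    (normc (wprod k n))^-1 * (M ^+ g / normc (wprod (k - g%:Z) g)).
Proof.
move=> wM; set j := k - g%:Z; have kE : k = j + g%:Z by rewrite /j subrK.
have jg := normc_wprod_gt0 j g.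
have e1 : wprod (j - n%:Z) n * wprod j g = wprod (j - n%:Z) g * wprod (k - n%:Z) n.
  have := wprodD (j - n%:Z) n g; rewrite addnC wprodD subrK => <-.
  by have -> : k - n%:Z = j - n%:Z + g%:Z by rewrite /j; ring.
have e2 : wprod j n * wprod (j + n%:Z) g = wprod j g * wprod k n.
  by have := wprodD j n g; rewrite addnC wprodD -kE => <-.
split.
  rewrite mulrA ler_pdivlMr// -normcM e1 normcM mulrC.
  by rewrite ler_wpM2l ?normc_ge0// normc_wprod_le.
have jn := normc_wprod_gt0 j n; have kn := normc_wprod_gt0 k n.
have xn := normc_wprod_gt0 (j + n%:Z) g.
have -> : (normc (wprod j n))^-1 =
    (normc (wprod k n))^-1 * (normc (wprod (j + n%:Z) g) / normc (wprod j g)).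
  have := congr1 (@normc R) e2; rewrite !normcM => e3.
  rewrite mulrCA -invfM [_ (wprod k n) * _]mulrC -e3 invfM mulrCA mulfV ?gt_eqF//.
  by rewrite mulr1.
apply: ler_wpM2l; first by rewrite invr_ge0 ltW.
by apply: ler_wpM2r; rewrite ?invr_ge0 ?(ltW jg) ?normc_wprod_le.
Qed.

(** [bwd k n] is the norm of [T^n e_k], and [fwd k n] is the inverse of the norm of
    the vector on the line of [e_(k+n)] that [T^n] sends to [e_k]. *)
Definition fwd (k : int) n : R := normc (wprod k n).
Definition bwd (k : int) n : R := normc (wprod (k - n%:Z) n).

(** The block is the preimage of [u] under [l T^n], supported [n] steps to the
    right; the smallness conditions at one large index [k] pass to all the basis
    vectors involved. *)
Lemma right_block_exists (M : R) (L : set C) : 1 <= M ->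
  (forall n, normc (w n) <= M) ->
  (forall (k : int) (e : R) n0, 0 < e -> exists n l,
     [/\ (n0 <= n)%N, L l, l != 0, normc l * bwd k n < e &
         (normc l)^-1 * (fwd k n)^-1 < e]) ->
  forall u X (d : R) s, 0 < d -> exists n l v, right_block T L u X v d s n l.
Proof.
move=> M1 wM H u X d s d0.
pose m := (\sum_(b <- u ++ X) `|b.1|)%N; pose k : int := m%:Z.
pose g (b : int * C) := `|k - b.1|%N.
have gE b : b \in u ++ X -> b.1 = k - (g b)%:Z.
  move=> bu; have bm : (`|b.1| <= m)%N by rewrite /m (big_rem b)//= leq_addr.
  exact: eq_sub_absz.
pose Kb (b : int * C) := normc b.2 * (M ^+ g b / normc (wprod b.1 (g b))).
have Kb0 b : 0 <= Kb b.
  rewrite !mulr_ge0 ?normc_ge0 ?exprn_ge0 ?invr_ge0 ?normc_ge0//.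
  exact: le_trans M1.
pose K := 1 + \sum_(b <- u ++ X) Kb b.
have K0 : 0 < K by rewrite ltr_pwDl// sumr_ge0.
have KuX : \sum_(b <- u) Kb b <= K /\ \sum_(b <- X) Kb b <= K.
  have su : 0 <= \sum_(b <- u) Kb b by exact: sumr_ge0.
  have sX : 0 <= \sum_(b <- X) Kb b by exact: sumr_ge0.
  by rewrite /K big_cat /=; split; lra.
have [n [l [n0n Ll l0 lb lf]]] := H k (d / K) (m + `|s| + 1)%N (divr_gt0 d0 K0).
have nl0 : 0 <= normc l by exact: normc_ge0.
have b0 : 0 <= bwd k n by exact: normc_ge0.
have f0 : 0 <= (fwd k n)^-1 by rewrite invr_ge0 normc_ge0.
exists n, l, [seq (b.1 + n%:Z, b.2 / (l * wprod b.1 n)) | b <- u]; split => //.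
- rewrite /comb big_map iter_sum scaler_sumr; apply: eq_bigr => b _ /=.
  rewrite iterZ_lin iter_basis addrK !scalerA; congr (_ *: _).
  by field; rewrite l0 wprod_neq0.
- apply: (le_lt_trans (nrm_comb_le _)); rewrite big_map /=.
  apply: (@le_lt_trans _ _ ((normc l)^-1 * (fwd k n)^-1 * \sum_(b <- u) Kb b)).
    rewrite mulr_sumr big_seq [leRHS]big_seq; apply: ler_sum => b bu.
    have bE := gE b; rewrite mem_cat bu in bE; have {}bE := bE isT.
    have [_ h2] := wprod_shift_le k n (g b) wM; rewrite -bE in h2.
    rewrite !(normcM, normcV) invfM -mulrA [normc b.2 * _]mulrC /Kb.
    rewrite -!mulrA; apply: ler_wpM2l; first by rewrite invr_ge0.
    rewrite [normc b.2 * _]mulrC mulrA; apply: ler_wpM2r; first exact: normc_ge0.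
    exact: h2.
  apply: (@le_lt_trans _ _ ((normc l)^-1 * (fwd k n)^-1 * K)).
    by apply: ler_wpM2l; [by rewrite mulr_ge0// invr_ge0|exact: KuX.1].
  by rewrite -ltr_pdivlMr.
- rewrite /comb iter_sum nrmZ.
  apply: (@le_lt_trans _ _ (normc l * bwd k n * \sum_(b <- X) Kb b)).
    rewrite -mulrA; apply: ler_wpM2l => //; apply: (le_trans (nrm_sum _ _)).
    rewrite mulr_sumr big_seq [leRHS]big_seq; apply: ler_sum => b bX.
    have bE := gE b; rewrite mem_cat bX orbT in bE; have {}bE := bE isT.
    have [h1 _] := wprod_shift_le k n (g b) wM; rewrite -bE in h1.
    rewrite iterZ_lin iter_basis !nrmZ /Kb [leRHS]mulrCA; apply: ler_wpM2l; first exact: normc_ge0.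
    apply: le_trans h1; apply: ler_piMr; [exact: normc_ge0|exact: nrm_basis].
  apply: (@le_lt_trans _ _ (normc l * bwd k n * K)).
    by apply: ler_wpM2l; [exact: mulr_ge0|exact: KuX.2].
  by rewrite -ltr_pdivlMr.
- move=> _ /mapP[b bu ->] /=.
  apply: lt_add_of_absz n0n.
  by rewrite /m (big_rem b) ?mem_cat ?bu//= leq_addr.
Qed.

End Shift.

(** * Sufficient conditions for hypercyclicity and supercyclicity *)

Section Criteria.
Context {R : realType} {p : R} {p1 : 1 <= p}.
Local Notation C := R[i].
Local Notation E := (lp p1).
Context (w : int -> C) (T : {linear E -> E}).
Hypothesis T_shift : is_bilateral_shift w T.

Lemma dense_of_approximable (A : set E) :
  (forall (y : E) (e : R), 0 < e -> exists2 z, A z & nrm (z - y) < e) -> dense A.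
Proof.
move=> H O [y Oy] oO; have := open_nbhs_nbhs (conj oO Oy).
move=> /nbhs_ballP[e /= e0 yO].
have eE : e = (normc e)%:C%C by rewrite -normr_normc ger0_norm// ltW.
have ne0 : 0 < normc e by rewrite normc_gt0 gt_eqF.
have [z Az zy] := H y _ ne0; exists z; split => //.
apply: yO; rewrite -ball_normE /ball_ /= normr_lp eE ltcR.
by rewrite nrmB.
Qed.

Lemma hypercyclic_criterion :
  (forall (k : int) (c : R) n0, 0 < c -> exists n,
     [/\ (n0 <= n)%N, c < fwd w k n & bwd w k n < c^-1]) ->
  hypercyclic T.
Proof.
move=> H; have [M M1 [TM wM]] := shift_bound T_shift.
have [|x Hx] := @universal_vector R p p1 T M M1 TM [set 1].
  apply: (right_block_exists T_shift M1 wM) => k e n0 e0.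
  have [|n [n0n cf bc]] := H k e^-1 n0; first by rewrite invr_gt0.
  exists n, 1; split=> //; rewrite ?oner_eq0// normc1 ?invr1 mul1r.
    by rewrite invrK in bc.
  rewrite -[ltRHS]invrK ltf_pV2 ?posrE ?invr_gt0//.
  exact: normc_wprod_gt0 T_shift k n.
exists x; apply: dense_of_approximable => y e e0.
have [n [l [-> xy]]] := Hx y e e0; rewrite scale1r in xy.
by exists (iter n T x) => //; exists n.
Qed.

Lemma supercyclic_criterion :
  (forall (k : int) (e : R) n0, 0 < e -> exists2 n,
     (n0 <= n)%N & bwd w k n <= e * fwd w k n) ->
  supercyclic T.
Proof.
move=> H; have [M M1 [TM wM]] := shift_bound T_shift.
have [|x Hx] := @universal_vector R p p1 T M M1 TM setT.
  apply: (right_block_exists T_shift M1 wM) => k e n0 e0.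
  have e20 : 0 < (e / 2) ^+ 2 by rewrite exprn_gt0// divr_gt0.
  have [n n0n bf] := H k _ n0 e20.
  have b0 : 0 < bwd w k n := normc_wprod_gt0 T_shift _ n.
  have f0 : 0 < fwd w k n := normc_wprod_gt0 T_shift _ n.
  (* the balance [|l| bwd = 1 / (|l| fwd)] makes both conditions the same one *)
  pose l : R := Num.sqrt (bwd w k n * fwd w k n)^-1.
  have l0 : 0 < l by rewrite sqrtr_gt0 invr_gt0 mulr_gt0.
  have l2 : l ^+ 2 = (bwd w k n * fwd w k n)^-1.
    by rewrite sqr_sqrtr// invr_ge0 mulr_ge0 ?ltW.
  have lbf : l * bwd w k n = l^-1 * (fwd w k n)^-1.
    apply: (mulfI (lt0r_neq0 l0)); rewrite !mulrA -expr2 l2 mulfV ?gt_eqF// mul1r.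
    by rewrite invfM mulrAC mulVf ?gt_eqF// mul1r.
  have lb : l * bwd w k n < e.
    apply: (@le_lt_trans _ _ (e / 2)); last by rewrite ltr_pdivrMr//; lra.
    rewrite -ler_sqr ?nnegrE; [|exact: mulr_ge0 (ltW l0) (ltW b0)|by rewrite divr_ge0// ltW].
    rewrite exprMn l2 invfM mulrAC expr2 mulrA mulVf ?gt_eqF// mul1r.
    by rewrite ler_pdivrMr.
  exists n, l%:C%C; split; rewrite ?normc_real ?(ltW l0) -?lbf//.
  by rewrite fmorph_eq0 gt_eqF.
exists x; apply: dense_of_approximable => y e e0.
have [n [l [_ xy]]] := Hx y e e0.
by exists (l *: iter n T x) => //; exists n, l.
Qed.

End Criteria.

(** * Limits of finitely supported functionals *)

Section Limit.
Context {R : realType}.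
Local Notation C := R[i].

Lemma ultrafilter_limit (T : Type) (U : set_system T) (r : T -> R) (B : R) :
  UltraFilter U -> (forall t, `|r t| <= B) -> exists l : R, r t @[t --> U] --> l.
Proof.
move=> UU rB; have UP : ProperFilter U by exact: ultra_proper.
have [|l [_ ll]] := @segment_compact R (- B) B (r @ U) _.
  by apply: (@filterE _ U) => t /=; rewrite in_itv /=; have := rB t; rewrite ler_norml.
exists l => V lV; have [//|UV] := in_ultra_setVsetC (r @^-1` V) UU.
by have [t []] := ll (~` V) V UV lV.
Qed.

(** An exponent [q] in [[2, 3]] at most the conjugate of [p], and larger than
    [2] exactly when [p < 2]. *)
Definition dual_exponent (p : R) : R := 1 + 2 / p.

Context {p : R} {p1 : 1 <= p} (p2 : p <= 2).
Local Notation E := (lp p1).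

Local Notation q := (dual_exponent p).

Let p0 : 0 < p. Proof. exact: lt_le_trans p1. Qed.

Lemma dual_exponent_bounds : 2 <= q <= 3.
Proof.
rewrite /q; have h1 : 1 <= 2 / p by rewrite ler_pdivlMr// mul1r.
have h2 : 2 / p <= 2 by rewrite ler_pdivrMr// ler_peMr.
by apply/andP; split; lra.
Qed.

(* Young's inequality without its optimal constants: compare [a] with
   [f ^ (q - 1)], where [q - 1 = 2 / p]. *)
Let young (a f : R) : 0 <= a <= 1 -> 0 <= f -> a * f <= a `^ p + f `^ q.
Proof.
move=> /andP[a0 a1] f0; have /andP[q2 q3] := dual_exponent_bounds.
have fq := powR_ge0 f q; have ap := powR_ge0 a p.
have [h|h] := leP a (f `^ (2 / p)).
  apply: (@le_trans _ _ (f `^ q)); last by rewrite lerDr.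
  have q1 : q - 1 = 2 / p by rewrite /dual_exponent addrAC subrr add0r.
  have qp : 0 < q by exact: lt_le_trans q2.
  by rewrite -(mulr_powRB1 f0 qp) q1 mulrC; apply: ler_wpM2l.
apply: (@le_trans _ _ (a `^ p)); last by rewrite lerDl.
have fa : f <= a `^ (p / 2).
  have pp : 2 / p * (p / 2) = 1 by field; rewrite gt_eqF.
  have -> : f = (f `^ (2 / p)) `^ (p / 2) by rewrite -powRrM pp powRr1.
  apply: ge0_ler_powR; [by rewrite divr_ge0// ltW|exact: powR_ge0|exact: a0|].
  exact: ltW.
apply: (le_trans (ler_wpM2l a0 fa)).
have [->|an0] := eqVneq a 0; first by rewrite mul0r powR_ge0.
have ap0 : 0 < a by rewrite lt0r an0.
rewrite -{1}(powRr1 a0) -powRD; last by rewrite an0 implybT.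
apply: ger_powR; first by rewrite ap0 a1.
by rewrite [leLHS]splitr lerD2r ler_pdivrMr// mul1r.
Qed.

Lemma normc_pairing_le (s : seq int) (f : int -> C) (y : E) : uniq s ->
  power_sum q s f <= 1 -> normc (pairing s y f) <= 2 * nrm y.
Proof.
move=> us f1; apply: (le_trans (normc_sum _ _)).
have [y0|y0] := eqVneq (nrm y) 0.
  rewrite y0 mulr0 big1// => i _; rewrite normcM.
  have -> : normc (y i) = 0; last by rewrite mul0r.
  by apply/eqP; rewrite eq_le normc_ge0 andbT -y0 normc_coord_le.
have yp : 0 < nrm y by rewrite lt0r y0 nrm_ge0.
rewrite -ler_pdivrMr// mulr_suml.
apply: (@le_trans _ _ (\sum_(i <- s)
    ((normc (y i) / nrm y) `^ p + normc (f i) `^ q))).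
  apply: ler_sum => i _; rewrite normcM mulrAC young ?normc_ge0//.
  by rewrite divr_ge0 ?normc_ge0 ?nrm_ge0//= ler_pdivrMr// mul1r normc_coord_le.
rewrite big_split /= -/(power_sum q s f).
have : \sum_(i <- s) (normc (y i) / nrm y) `^ p <= 1; last by lra.
rewrite (eq_bigr (fun i => (nrm y `^ p)^-1 * normc (y i) `^ p)); last first.
  move=> i _; rewrite powRM ?invr_ge0 ?normc_ge0 ?nrm_ge0// mulrC; congr (_ * _).
  by rewrite -(powR_inv1 (ltW yp)) -powRrM mulN1r powRN.
have ypp : 0 < nrm y `^ p by exact: powR_gt0 yp.
rewrite -mulr_sumr (ler_pdivrMl _ _ ypp) mulr1.
exact: lp_seq_sum_le.
Qed.

(** Weak-star compactness of the dual ball: an ultrafilter limit of finitely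
    supported functionals. *)
Lemma weak_star_limit (s : nat -> seq int) (f : nat -> int -> C) :
  (forall N, uniq (s N)) -> (forall N, power_sum q (s N) (f N) <= 1) ->
  exists2 g : {linear E -> C^o}, continuous g & forall (y : E) (b : R), 0 <= b ->
    ((exists N0, forall N, (N0 <= N)%N -> normc (pairing (s N) y (f N)) <= b) ->
      normc (g y) <= b) /\
    ((exists N0, forall N, (N0 <= N)%N -> b <= normc (pairing (s N) y (f N))) ->
      b <= normc (g y)).
Proof.
move=> us f1.
have [U [UU sU]] := ultraFilterLemma (@eventually_filter).
have UP : ProperFilter U by exact: ultra_proper.
pose a (y : E) N := pairing (s N) y (f N).
have aB y N : normc (a y N) <= 2 * nrm y by exact: normc_pairing_le.
have normc_sq (z : C) : normc z ^+ 2 = complex.Re z ^+ 2 + complex.Im z ^+ 2.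
  by case: z => x1 x2; rewrite /= sqr_sqrtr// addr_ge0 ?sqr_ge0.
have ReB (z : C) : `|complex.Re z| <= normc z.
  rewrite -ler_sqr ?nnegrE ?normc_ge0// real_normK ?num_real// normc_sq.
  by rewrite lerDl sqr_ge0.
have ImB (z : C) : `|complex.Im z| <= normc z.
  rewrite -ler_sqr ?nnegrE ?normc_ge0// real_normK ?num_real// normc_sq.
  by rewrite lerDr sqr_ge0.
have /choice[g Hg] : forall y : E, exists z : C,
    (complex.Re (a y N) @[N --> U] --> complex.Re z) /\
    (complex.Im (a y N) @[N --> U] --> complex.Im z).
  move=> y; have [|l1 H1] := @ultrafilter_limit _ U (fun N => complex.Re (a y N)) (2 * nrm y) UU.
    by move=> N; exact: le_trans (aB y N).
  have [|l2 H2] := @ultrafilter_limit _ U (fun N => complex.Im (a y N)) (2 * nrm y) UU.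
    by move=> N; exact: le_trans (aB y N).
  by exists (l1 +i* l2)%C.
have normg y : normc (a y N) ^+ 2 @[N --> U] --> normc (g y) ^+ 2.
  have [H1 H2] := Hg y; rewrite normc_sq.
  under eq_fun do rewrite normc_sq.
  by apply: cvgD; [apply: cvgM|apply: cvgM].
have glin c y z : g (c *: y + z) = c * g y + g z.
  have aE N : a (c *: y + z) N = c * a y N + a z N.
    rewrite /a /pairing mulr_sumr -big_split; apply: eq_bigr => i _.
    by rewrite lp_add lp_scale mulrDl mulrA.
  have [H1 H2] := Hg (c *: y + z); have [K1 K2] := Hg y; have [J1 J2] := Hg z.
  apply/eqP; rewrite eq_complex; apply/andP; split; apply/eqP.
    apply: (cvg_unique _ H1) => //.
    have -> : complex.Re (c * g y + g z) = complex.Re c * complex.Re (g y) -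
        complex.Im c * complex.Im (g y) + complex.Re (g z).
      by case: (c) (g y) (g z) => [? ?] [? ?] [? ?].
    rewrite (_ : (fun N => _) = (fun N => complex.Re c * complex.Re (a y N) -
        complex.Im c * complex.Im (a y N) + complex.Re (a z N))).
      by apply: cvgD => //; apply: cvgB; apply: cvgMr.
    by apply/funext => N; rewrite aE; case: (c) (a y N) (a z N) => [? ?] [? ?] [? ?].
  apply: (cvg_unique _ H2) => //.
  have -> : complex.Im (c * g y + g z) = complex.Re c * complex.Im (g y) +
      complex.Im c * complex.Re (g y) + complex.Im (g z).
    by case: (c) (g y) (g z) => [? ?] [? ?] [? ?].
  rewrite (_ : (fun N => _) = (fun N => complex.Re c * complex.Im (a y N) +
      complex.Im c * complex.Re (a y N) + complex.Im (a z N))).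
    by apply: cvgD => //; apply: cvgD; apply: cvgMr.
  by apply/funext => N; rewrite aE; case: (c) (a y N) (a z N) => [? ?] [? ?] [? ?].
have near_of (P : nat -> Prop) : (exists N0, forall N, (N0 <= N)%N -> P N) ->
    \forall N \near U, P N.
  by move=> [N0 HN]; apply: sU; exists N0.
have gle y (b : R) : 0 <= b ->
    (\forall N \near U, normc (a y N) <= b) -> normc (g y) <= b.
  move=> b0 H; rewrite -ler_sqr ?nnegrE ?normc_ge0//.
  apply: (cvgr_to_le (normg y)); apply: filterS H => N ab.
  by rewrite ler_sqr ?nnegrE ?normc_ge0.
have gge y (b : R) : 0 <= b ->
    (\forall N \near U, b <= normc (a y N)) -> b <= normc (g y).
  move=> b0 H; rewrite -ler_sqr ?nnegrE ?normc_ge0//.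
  apply: (cvgr_to_ge (normg y)); apply: filterS H => N ab.
  by rewrite ler_sqr ?nnegrE ?normc_ge0.
have [|G Gc GE] := @bounded_functional R p p1 g 2 glin.
  move=> y; apply: gle; first by rewrite mulr_ge0 ?nrm_ge0.
  by apply: filterE => N; exact: aB.
exists G => // y b b0; rewrite GE; split => /near_of H; [exact: gle|exact: gge].
Qed.

End Limit.

(** * From weak to norm cyclicity *)

Section WeakToNorm.
Context {R : realType} {p : R} {p1 : 1 <= p} (p2 : p <= 2).
Local Notation C := R[i].
Local Notation E := (lp p1).
Local Notation q := (dual_exponent p).

Let p0 : 0 < p. Proof. exact: lt_le_trans p1. Qed.
Let q0 : 0 < q.
Proof. by have /andP[q2 _] := @dual_exponent_bounds R p p1 p2; exact: lt_le_trans q2. Qed.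

Lemma functional_scale (g : {linear E -> C^o}) (a : C) (y : E) :
  g (a *: y) = a * g y :> C.
Proof. by rewrite linearZ. Qed.

Lemma big_restrict (V : nmodType) (s t : seq int) (F : int -> V) :
  uniq s -> uniq t -> {subset t <= s} ->
  \sum_(i <- s) (if i \in t then F i else 0) = \sum_(i <- t) F i.
Proof.
move=> us ut ts; rewrite -big_mkcond -big_filter; apply: perm_big.
apply: uniq_perm; rewrite ?filter_uniq// => i; rewrite mem_filter.
by case: (boolP (i \in t)) => // /ts ->.
Qed.

(** The plank theorem turned into a functional. Only finitely many vectors [y n],
    [n \in A N], are treated at stage [N], with test functions supported away from
    the coordinate [k]; the limit functional vanishes at [e_k] and stays away from
    zero on every vector that is eventually treated. *)
Lemma plank_functional (k : int) (y : nat -> E) (A : nat -> seq nat) (B : R) :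
  0 < B ->
  (forall N, exists (s : seq int) (G : nat -> int -> C) (h : nat -> R),
     [/\ uniq s, k \notin s,
       (forall n, n \in A N -> [/\ 0 < h n, h n <= normc (pairing s (y n) (G n)) &
                                power_sum q s (G n) <= 1]) &
       \sum_(n <- A N) (h n) ^- 2 <= B]) ->
  exists (g : {linear E -> C^o}) (d : R),
    [/\ continuous g, g (lp_basis p1 k) = 0, 0 < d &
        forall n, (exists N0, forall N, (N0 <= N)%N -> n \in A N) ->
          d <= normc (g (y n))].
Proof.
move=> B0 H; have [D D0 HD] := @complex_plank R int nat.
have q23 := @dual_exponent_bounds R p p1 p2.
have /choice[F HF] : forall N, exists sf : seq int * (int -> C),
    [/\ uniq sf.1, k \notin sf.1, power_sum q sf.1 sf.2 <= 1 &
      forall n, n \in A N ->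
        1 <= D * B * normc (pairing sf.1 (y n) sf.2) ^+ 2].
  move=> N; have [s [G [h [us ks Hn hB]]]] := H N.
  have [f f1 Hf] := HD q s (A N) (fun n => y n) G h B q23 B0 Hn hB.
  by exists (s, f).
have [||g gc Hg] := @weak_star_limit R p p1 p2 (fun N => (F N).1) (fun N => (F N).2).
- by move=> N; have [] := HF N.
- by move=> N; have [] := HF N.
have DB0 : 0 < D * B by rewrite mulr_gt0.
have sD0 : 0 < (Num.sqrt (D * B))^-1 by rewrite invr_gt0 sqrtr_gt0.
exists g, (Num.sqrt (D * B))^-1; split=> //; last first.
- move=> n [N0 HN0]; have [_ + ] := Hg (y n) _ (ltW sD0).
  apply; exists N0 => N /HN0 nA; have [_ _ _ /(_ n nA) K] := HF N.
  rewrite -ler_sqr ?nnegrE ?normc_ge0 ?invr_ge0 ?sqrtr_ge0//.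
  by rewrite exprVn sqr_sqrtr ?(ltW DB0)// -(ler_pM2l DB0) mulfV ?gt_eqF.
- apply/eqP; rewrite -normc_eq0 eq_le normc_ge0 andbT.
  have [+ _] := Hg (lp_basis p1 k) 0 (lexx 0); apply; exists 0%N => N _.
  have [_ ks _ _] := HF N; rewrite /pairing big_seq big1 ?normc0// => i is_.
  rewrite basisE; case: eqP => [ik|_]; last by rewrite mul0r.
  by rewrite ik (negbTE ks) in is_.
Qed.

Let quotient_bound (e a Q X f b : R) : 0 < Q -> 0 < X -> 0 < f -> 0 <= a ->
  e * f <= b * Q -> e * a / Q / X <= (f * X)^-1 * (b * a).
Proof.
move=> Q0 X0 f0 a0 h.
have -> : (f * X)^-1 * (b * a) = e * a / Q / X + a / (f * X * Q) * (b * Q - e * f).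
  by field; rewrite !gt_eqF.
by rewrite lerDl mulr_ge0 ?subr_ge0// divr_ge0 ?mulr_ge0// ltW.
Qed.

(** The inclusion of [l_p] in [l_2]. *)
Lemma lp_square_sum_le (x : E) (s : seq int) : uniq s ->
  \sum_(j <- s) normc (x j) ^+ 2 <= nrm x ^+ 2.
Proof.
move=> us; have sq (a : R) : 0 <= a -> a ^+ 2 = a `^ p * a `^ (2 - p).
  move=> a0; rewrite -powRD; last by rewrite addrC subrK pnatr_eq0.
  by rewrite [p + _]addrC subrK powR_mulrn.
rewrite (sq _ (nrm_ge0 x)); apply: (@le_trans _ _
    (\sum_(j <- s) normc (x j) `^ p * nrm x `^ (2 - p))).
  apply: ler_sum => j _; rewrite sq ?normc_ge0//; apply: ler_wpM2l; first exact: powR_ge0.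
  by apply: ge0_ler_powR; rewrite ?nnegrE ?normc_ge0 ?nrm_ge0 ?subr_ge0 ?normc_coord_le.
by rewrite -mulr_suml; apply: ler_wpM2r; [exact: powR_ge0|exact: lp_seq_sum_le].
Qed.

Context (w : int -> C) (T : {linear E -> E}).
Hypothesis T_shift : is_bilateral_shift w T.

Lemma projective_orbit_coord_neq0 (x : E) (k : int) :
  weakly_dense (projective_orbit T x) -> exists m : nat, x (k + m%:Z) != 0.
Proof.
move=> xd; have [fk fkc fkE] := @coord_functional R p p1 k.
have [|_ [n [l ->]] [+ _]] :=
    weakly_dense_meets fkc fkc (@open_normc_gt R 0) (@open_normc_gt R 0) xd.
  by exists (lp_basis p1 k); rewrite fkE basis_diag /mkset normc1 ltr01.
rewrite fkE /mkset => H; exists n; apply: contraTneq H => x0.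
by rewrite lp_scale (iter_coord T_shift) x0 !mulr0 normc0 ltxx.
Qed.

(** Otherwise [x] would be a multiple of a basis vector, and so would every element
    of its projective orbit. *)
Lemma projective_orbit_other_coord (x : E) (k : int) n :
  weakly_dense (projective_orbit T x) -> exists2 j, j != k & iter n T x j != 0.
Proof.
move=> xd; apply: contrapT => H.
have xz j : j != k + n%:Z -> x j = 0.
  move=> jk; apply/eqP; apply: contrapT => /negP xj; apply: H.
  exists (j - n%:Z); first by rewrite subr_eq.
  by rewrite (iter_coord T_shift) subrK mulf_neq0// (wprod_neq0 T_shift).
have [f0 f0c f0E] := @coord_functional R p p1 0.
have [f1 f1c f1E] := @coord_functional R p p1 1.
have [|_ [m [l ->]] []] :=
    weakly_dense_meets f0c f1c (@open_normc_gt R 0) (@open_normc_gt R 0) xd.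
  exists (lp_basis p1 0 + lp_basis p1 1).
  by rewrite f0E f1E !lp_add !basis_diag !basis_off// addr0 add0r /mkset normc1 ltr01.
rewrite f0E f1E /mkset !lp_scale !(iter_coord T_shift) => h0 h1.
have e0 : 0 + m%:Z = k + n%:Z.
  by apply/eqP; apply: contraTT h0 => /xz ->; rewrite !mulr0 normc0 ltxx.
have : 1 + m%:Z != k + n%:Z by rewrite -e0 (inj_eq (addIr _)).
by move=> /xz x1; rewrite x1 !mulr0 normc0 ltxx in h1.
Qed.

(** If the criterion fails, for large [n] the normalized orbit vector of index
    [n] has a coordinate of size at least [c / |x_(k+n)|], and the inverses of these numbers
    are square summable because [p <= 2]. *)
Lemma weakly_supercyclic_supercyclic : weakly_supercyclic T -> supercyclic T.
Proof.
move=> [x xd]; apply: contrapT => nS.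
have [k [e [n0 [e0 Hb]]]] : exists (k : int) (e : R) n0, 0 < e /\
    forall n, (n0 <= n)%N -> e * fwd w k n < bwd w k n.
  apply: contrapT => H; apply: nS; apply: (supercyclic_criterion T_shift) => k e n0 e0.
  apply: contrapT => H'; apply: H; exists k, e, n0; split => // n n0n.
  by rewrite ltNge; apply/negP => H2; apply: H'; exists n.
have [M M1 [TM wM]] := shift_bound T_shift.
have [m xm] := projective_orbit_coord_neq0 k xd.
pose y n : E := (iter n T x k)^-1 *: iter n T x.
pose P n := x (k + n%:Z) != 0.
have Tk n : iter n T x k = wprod w k n * x (k + n%:Z) by exact: iter_coord.
have Tk0 n : P n -> iter n T x k != 0.
  by move=> Pn; rewrite Tk mulf_neq0// (wprod_neq0 T_shift).
pose c := e * (normc (wprod w k m) * normc (x (k + m%:Z))) / M ^+ m.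
have M0 : 0 < M by rewrite (lt_le_trans ltr01).
have c0 : 0 < c.
  by rewrite divr_gt0 ?exprn_gt0// !mulr_gt0 ?(normc_wprod_gt0 T_shift) ?normc_gt0.
(* the failure of the criterion says nothing about the indices below [n1]; there,
   any nonzero coordinate other than [k] will do *)
pose n1 := (n0 + m).+1.
have /choice[F HF] : forall n, exists jh : int * R, P n ->
    [/\ jh.1 != k, 0 < jh.2, jh.2 <= normc (y n jh.1) &
        (n1 <= n)%N -> jh.2 ^- 2 <= c ^- 2 * normc (x (k + n%:Z)) ^+ 2].
  move=> n; have [Pn|nPn] := boolP (P n); last by exists (0, 0).
  have xn : 0 < normc (x (k + n%:Z)) by rewrite normc_gt0.
  have [n1n|nn1] := leqP n1 n; last first.
    have [j jk yj] := projective_orbit_other_coord k n xd.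
    exists (j, normc (y n j)) => _; split => //.
    by rewrite -[ltRHS]/(normc (lp_fun (y n) j)) /y lp_scale normc_gt0 mulf_neq0 ?invr_eq0 ?Tk0.
  pose r := (n - m)%N; have mn : (m <= n)%N.
    by apply: leq_trans n1n; rewrite /n1 ltnW// ltnS leq_addl.
  have nE : n = (r + m)%N by rewrite subnK.
  have n0r : (n0 <= r)%N by rewrite leq_subRL// addnC ltnW.
  have r0 : r%:Z != 0.
    by rewrite eqz_nat -lt0n subn_gt0 (leq_trans _ n1n)// /n1 ltnS leq_addl.
  exists (k - r%:Z, c / normc (x (k + n%:Z))) => _; split => /=.
  - by rewrite -subr_eq0 addrC addKr oppr_eq0.
  - exact: divr_gt0.
  - have h1 : wprod w (k - r%:Z) n = wprod w (k - r%:Z) r * wprod w k m.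
      by rewrite nE wprodD subrK.
    have h2 : fwd w k n <= fwd w k r * M ^+ m.
      rewrite /fwd nE wprodD normcM; apply: ler_wpM2l; first exact: normc_ge0.
      exact: normc_wprod_le.
    have h3 : k - r%:Z + n%:Z = k + m%:Z by rewrite nE PoszD addrA subrK.
    have f0 : 0 < fwd w k n := normc_wprod_gt0 T_shift _ n.
    have -> : normc (y n (k - r%:Z)) = (fwd w k n * normc (x (k + n%:Z)))^-1 *
        (bwd w k r * (normc (wprod w k m) * normc (x (k + m%:Z)))).
      rewrite /y lp_scale (iter_coord T_shift n x (k - r%:Z)) h1 h3 Tk !normcM normcV normcM.
      by rewrite -/(fwd w k n) -/(bwd w k r) !mulrA.
    apply: quotient_bound => //; rewrite ?exprn_gt0 ?mulr_ge0 ?normc_ge0//.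
    apply: (@le_trans _ _ (e * (fwd w k r * M ^+ m))); first by rewrite ler_pM2l.
    by rewrite mulrA ler_wpM2r ?exprn_ge0 ?(ltW M0)// ltW// Hb.
  - by move=> _; rewrite exprMn exprVn invfM invrK.
pose s N := [seq j <- undup [seq (F n).1 | n <- iota 0 N] | j != k].
pose A N := [seq n <- iota 0 N | P n].
pose B := 1 + \sum_(n <- iota 0 n1) (F n).2 ^- 2 + c ^- 2 * nrm x ^+ 2.
have S0 : 0 <= \sum_(n <- iota 0 n1) (F n).2 ^- 2.
  by apply: sumr_ge0 => n _; rewrite invr_ge0 sqr_ge0.
have B0 : 0 < B.
  by rewrite !ltr_wpDr// mulr_ge0 ?invr_ge0 ?sqr_ge0.
have [N|g [d [gc gk d0 Hg]]] := @plank_functional k y A B B0 _.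
  exists (s N), (fun n i => (i == (F n).1)%:R), (fun n => (F n).2); split.
  - by rewrite filter_uniq// undup_uniq.
  - by rewrite mem_filter eqxx.
  - move=> n; rewrite mem_filter => /andP[Pn nN]; have [jk h0 hy _] := HF n Pn.
    have js : (F n).1 \in s N.
      by rewrite mem_filter jk mem_undup; apply/mapP; exists n.
    have us : uniq (s N) by rewrite filter_uniq// undup_uniq.
    split => //.
    + rewrite /pairing (big_rem _ js) /= eqxx mulr1 big_seq big1 ?addr0// => i.
      by rewrite mem_rem_uniq// inE => /andP[/negbTE -> _]; rewrite mulr0.
    + rewrite /power_sum (big_rem _ js) /= eqxx normc1 powR1 big_seq big1 ?addr0// => i.
      by rewrite mem_rem_uniq// inE => /andP[/negbTE -> _]; rewrite normc0 powR0 ?gt_eqF.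
  - rewrite /A big_filter /B.
    apply: (@le_trans _ _ (\sum_(n <- iota 0 N | P n)
      ((if (n < n1)%N then (F n).2 ^- 2 else 0) + c ^- 2 * normc (x (k + n%:Z)) ^+ 2))).
      apply: ler_sum => n Pn; have [_ _ _ Hn] := HF n Pn.
      case: ltnP => [_|/Hn]; last by rewrite add0r.
      by rewrite lerDl mulr_ge0 ?invr_ge0 ?sqr_ge0.
    rewrite big_split /=; apply: lerD.
      apply: (@le_trans _ _ (\sum_(n <- iota 0 N | (n < n1)%N) (F n).2 ^- 2)).
        rewrite [leRHS]big_mkcond [leLHS]big_mkcond; apply: ler_sum => n _.
        by case: (P n) => //; case: ifP => // _; rewrite invr_ge0 sqr_ge0.
      apply: (@le_trans _ _ (\sum_(n <- iota 0 n1) (F n).2 ^- 2)); last by rewrite lerDr.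
      rewrite -big_filter [leRHS](bigID (fun n => n < N)%N) /=.
      rewrite -[X in _ <= X + _]big_filter.
      have -> : [seq n <- iota 0 N | (n < n1)%N] = [seq n <- iota 0 n1 | (n < N)%N].
        apply: (sorted_eq leq_trans anti_leq); rewrite ?sorted_filter ?iota_sorted//;
          try exact: leq_trans.
        apply: uniq_perm; rewrite ?filter_uniq ?iota_uniq// => n.
        by rewrite !mem_filter !mem_iota !add0n /= andbC.
      by rewrite lerDl sumr_ge0// => n _; rewrite invr_ge0 sqr_ge0.
    rewrite -mulr_sumr; apply: ler_wpM2l; first by rewrite invr_ge0 sqr_ge0.
    apply: le_trans (lp_square_sum_le x (_ : uniq [seq k + n%:Z | n <- iota 0 N])).
      rewrite big_map big_mkcond; apply: ler_sum => n _.
      by case: ifP => // _; rewrite sqr_ge0.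
    by rewrite map_inj_uniq ?iota_uniq// => a b /addrI[].
have [fk fkc fkE] := @coord_functional R p p1 k.
have [|_ [n [l ->]] []] :=
    weakly_dense_meets fkc gc (@open_normc_gt R 1) (@open_normc_lt R d) xd.
  exists (2%:R *: lp_basis p1 k); rewrite fkE functional_scale gk lp_scale basis_diag /mkset.
  by rewrite mulr0 normc0 mulr1 -[2%:R : C](rmorph_nat (real_complex R)) normc_real// ltr1n.
rewrite fkE /mkset lp_scale => zk gz.
have Pn : P n.
  by apply: contraTT zk => /negPn/eqP x0; rewrite Tk x0 !mulr0 normc0 -leNgt.
have nA : exists N0, forall N, (N0 <= N)%N -> n \in A N.
  by exists n.+1 => N nN; rewrite mem_filter Pn mem_iota.
have := Hg n nA; move: gz; rewrite /mkset /y !functional_scale => gz Hd.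
have : d <= normc (l * g (iter n T x)).
  apply: (le_trans Hd); rewrite !normcM; apply: ler_wpM2r; first exact: normc_ge0.
  rewrite normcV -[leLHS]mul1r ler_pdivrMr ?normc_gt0 ?Tk0//.
  by rewrite -normcM ltW.
by rewrite leNgt gz.
Qed.

(** If the criterion fails, then of any two orbit vectors that are large at [k],
    one inherits from the other a coordinate of size at least [c^-1]. The
    numbers of such coordinates are the out-degrees of a tournament, hence grow
    linearly, and for [p < 2] this makes the inverse squares of the norms in the
    predual of [l_q] summable. *)
Lemma weakly_hypercyclic_hypercyclic : p < 2 -> weakly_hypercyclic T -> hypercyclic T.
Proof.
move=> plt2 [x xd]; apply: contrapT => nH.
have [M M1 [TM wM]] := shift_bound T_shift.
have M0 : 0 < M by rewrite (lt_le_trans ltr01).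
have [k [c [c0 Hc]]] : exists (k : int) (c : R), 0 < c /\
    forall n, fwd w k n <= c \/ c^-1 <= bwd w k n.
  apply: contrapT => H; apply: nH; apply: (hypercyclic_criterion T_shift) => k c n0 c0.
  apply: contrapT => H'; apply: H; exists k, (Num.max c (M ^+ n0)); split.
    by rewrite lt_max c0.
  move=> n; have [n0n|nn0] := leqP n0 n; last first.
    left; rewrite le_max; apply/orP; right; apply: (le_trans (normc_wprod_le _ _ wM)).
    by apply: ler_weXn2l => //; exact: ltnW.
  have [fc|cf] := leP (fwd w k n) c; first by left; rewrite le_max fc.
  have [bc|cb] := leP c^-1 (bwd w k n); last by exfalso; apply: H'; exists n.
  right; apply: le_trans bc; rewrite lef_pV2 ?posrE ?lt_max ?c0//.
  by rewrite le_max lexx.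
pose y n : E := iter n T x.
pose P n := 1 < normc (y n k).
pose e n m := c^-1 <= normc (y n (k + m%:Z - n%:Z)).
have yk n : y n k = wprod w k n * x (k + n%:Z) by exact: iter_coord.
(* [T ^ (m - n)] carries the coordinate [k + m - n] of [y n] to the coordinate [k] of
   [y m], and the coordinate [k] of [y n] to the coordinate [k + n - m] of [y m] *)
have He n m : (n < m)%N -> P n -> P m -> e m n || e n m.
  move=> nm Pn Pm; pose d := (m - n)%N; have mE : m = (d + n)%N by rewrite subnK// ltnW.
  have [fd|bd] := Hc d.
    apply/orP; right; rewrite /e.
    have pos : k + m%:Z - n%:Z = k + d%:Z by rewrite mE PoszD; ring.
    have : normc (y m k) = fwd w k d * normc (y n (k + m%:Z - n%:Z)).
      rewrite yk [in LHS]mE wprodD pos (iter_coord T_shift n x) !normcM mulrA.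
      by rewrite -addrA -PoszD.
    move=> ymE; rewrite -(ler_pM2l c0) mulfV ?gt_eqF//.
    apply: (le_trans (ltW Pm)); rewrite ymE; apply: ler_wpM2r => //; exact: normc_ge0.
  apply/orP; left; rewrite /e.
  have pos : k + n%:Z - m%:Z = k - d%:Z by rewrite mE PoszD; ring.
  have -> : y m (k + n%:Z - m%:Z) = wprod w (k - d%:Z) d * y n k.
    rewrite pos (iter_coord T_shift m x) mE wprodD subrK yk mulrA; congr (_ * x _).
    by rewrite PoszD; ring.
  rewrite normcM -/(bwd w k d); apply: (le_trans bd).
  by rewrite ler_peMr ?normc_ge0// ltW.
pose r N := [seq n <- iota 0 N | P n].
have ur N : uniq (r N) by rewrite filter_uniq ?iota_uniq.
pose b N n := outdegree e (r N) n.
pose A N := [seq n <- r N | (0 < b N n)%N].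
pose pos n m : int := k + m%:Z - n%:Z.
pose Es N n := [seq pos n m | m <- [seq m <- r N | (m != n) && e n m]].
have uE N n : uniq (Es N n).
  rewrite map_inj_uniq; first by rewrite filter_uniq.
  by move=> m m' /addIr/addrI[].
have sE N n : size (Es N n) = b N n by rewrite size_map size_filter.
have q23 := @dual_exponent_bounds R p p1 p2.
have q2 : 2 < q.
  by rewrite /dual_exponent; have : 1 < 2 / p; [rewrite ltr_pdivlMr// mul1r|lra].
pose t := 1 - q^-1; pose sg := 2 * t.
have t0 : 0 < t by rewrite subr_gt0 invf_lt1//; lra.
have sg1 : 1 < sg.
  have : q^-1 < 2^-1 by rewrite ltf_pV2 ?posrE//.
  by rewrite /sg /t; lra.
pose B := c ^+ 2 * (4 `^ sg * (1 + (sg - 1)^-1)).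
have B0 : 0 < B.
  by rewrite !mulr_gt0 ?exprn_gt0 ?powR_gt0 ?ltr0n ?addr_gt0 ?invr_gt0 ?subr_gt0.
(* the phases of the test functions [G n], which align the chosen coordinates *)
pose ph (z : C) : C := ((normc z)^-1)%:C%C * z^*%C.
have phE (z : C) : z != 0 -> z * ph z = (normc z)%:C%C /\ normc (ph z) = 1.
  move=> z0; have nz : 0 < normc z by rewrite normc_gt0.
  split; last by rewrite /ph normcM normc_conj normc_real ?invr_ge0 ?ltW// mulVf ?gt_eqF.
  rewrite /ph mulrCA -sqr_normc normr_normc -rmorphXn -rmorphM /= expr2.
  by rewrite mulKf ?gt_eqF.
have [N|g [d [gc gk d0 Hg]]] := @plank_functional k y A B B0 _.
  pose G n i : C := if i \in Es N n then ((b N n)%:R `^ (- q^-1))%:C%C * ph (y n i) else 0.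
  pose s := [seq j <- undup (flatten [seq Es N n | n <- r N]) | j != k].
  have us : uniq s by rewrite filter_uniq// undup_uniq.
  have Es_s n : n \in r N -> {subset Es N n <= s}.
    move=> nr j jE; rewrite mem_filter mem_undup; apply/andP; split; last first.
      by apply/flatten_mapP; exists n.
    move: jE => /mapP[m]; rewrite mem_filter => /andP[/andP[mn _] _] ->.
    by rewrite /pos -addrA -subr_eq0 addrAC subrr add0r subr_eq0 eqz_nat.
  exists s, G, (fun n => c^-1 * (b N n)%:R `^ t); split => //.
  - by rewrite mem_filter eqxx.
  - move=> n; rewrite mem_filter => /andP[b0 nr].
    have bR : 0 < (b N n)%:R :> R by rewrite ltr0n.
    have bq : 0 < (b N n)%:R `^ (- q^-1) :> R by exact: powR_gt0.
    have yE i : i \in Es N n -> c^-1 <= normc (y n i).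
      by move=> /mapP[m]; rewrite mem_filter => /andP[/andP[_ em] _] ->.
    have yn0 i : i \in Es N n -> y n i != 0.
      by move=> /yE cy; rewrite -normc_gt0 (lt_le_trans _ cy)// invr_gt0.
    split; first by rewrite mulr_gt0 ?invr_gt0 ?powR_gt0.
    + have -> : pairing s (y n) (G n) =
          (\sum_(i <- Es N n) (b N n)%:R `^ (- q^-1) * normc (y n i))%:C%C.
        rewrite -(big_restrict _ us (uE N n) (Es_s n nr)) rmorph_sum.
        apply: eq_bigr => i _; rewrite /G; case: ifP => iE; last by rewrite mulr0.
        by rewrite mulrCA (phE _ (yn0 i iE)).1 -rmorphM.
      rewrite normc_real; last by apply: sumr_ge0 => i _; rewrite mulr_ge0 ?normc_ge0 ?powR_ge0.
      rewrite -mulr_sumr.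
      apply: (@le_trans _ _ ((b N n)%:R `^ (- q^-1) * ((b N n)%:R * c^-1))).
        have -> : (b N n)%:R `^ t = (b N n)%:R `^ (- q^-1) * (b N n)%:R.
          rewrite /t addrC powRD; last by rewrite (gt_eqF bR) /= implybT.
          by rewrite powRr1// ltW.
        by rewrite mulrC -mulrA.
      apply: ler_wpM2l; first exact: ltW.
      rewrite -sE -sum1_size natr_sum mulr_suml big_seq [leRHS]big_seq.
      by apply: ler_sum => i iE; rewrite mul1r yE.
    + rewrite /power_sum.
      have -> : \sum_(i <- s) normc (G n i) `^ q =
          \sum_(i <- s) (if i \in Es N n then (b N n)%:R^-1 else 0).
        apply: eq_bigr => i _; rewrite /G; case: ifP => iE; last first.
          by rewrite normc0 powR0// gt_eqF.
        rewrite normcM (phE _ (yn0 i iE)).2 mulr1 normc_real ?powR_ge0//.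
        by rewrite -powRrM mulNr mulVf ?gt_eqF// powR_inv1 ?ltW.
      rewrite (big_restrict _ us (uE N n) (Es_s n nr)).
      by rewrite big_const_seq count_predT iter_addr_0 sE -[leLHS]mulr_natl mulfV ?gt_eqF.
  - rewrite /A big_filter.
    rewrite (eq_bigr (fun n => c ^+ 2 * ((b N n)%:R `^ sg)^-1)); last first.
      move=> n _; rewrite exprMn invfM exprVn invrK; congr (_ * _^-1).
      by rewrite -powR_mulrn ?powR_ge0// -powRrM mulrC.
    rewrite -mulr_sumr; apply: ler_wpM2l; first by rewrite exprn_ge0// ltW.
    apply: (@le_trans _ _ (4 `^ sg * \sum_(i < size (r N)) (i.+1%:R `^ sg)^-1)).
      apply: (tournament_sum (e := e)) => //; first by rewrite (le_trans ler01)// ltW.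
      move=> m n; rewrite !mem_filter => /andP[Pm _] /andP[Pn _].
      rewrite neq_ltn => /orP[mn|nm]; last exact: He.
      by rewrite orbC He.
    by apply: ler_wpM2l; [exact: powR_ge0|exact: riemann_sum_bound].
have active n m : P n -> P m -> m != n -> e n m ->
    exists N0, forall N, (N0 <= N)%N -> n \in A N.
  move=> Pn Pm mn enm; exists (n + m).+1 => N nmN.
  have nr : n \in r N.
    by rewrite mem_filter Pn mem_iota add0n (leq_trans _ nmN)// ltnS leq_addr.
  have mr : m \in r N.
    by rewrite mem_filter Pm mem_iota add0n (leq_trans _ nmN)// ltnS leq_addl.
  by rewrite mem_filter nr andbT /b /outdegree -has_count; apply/hasP; exists m; rewrite ?mn.
(* at most one vector is never treated, and a threshold on the coordinate [k]
   excludes it *)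
have [rho rho1 Hrho] : exists2 rho : R, 1 <= rho & forall n, rho < normc (y n k) ->
    exists N0, forall N, (N0 <= N)%N -> n \in A N.
  have [[n1 [Pn1 nact]]|all_act] := pselect (exists n, P n /\
      ~ exists N0, forall N, (N0 <= N)%N -> n \in A N); last first.
    by exists 1 => // n Pn; apply: contrapT => nact; apply: all_act; exists n.
  exists (normc (y n1 k)) => [|n yn]; first exact: ltW.
  have Pn : P n by exact: lt_trans yn.
  have nn1 : n != n1 by apply: contraTneq yn => ->; rewrite ltxx.
  have : e n n1 || e n1 n.
    by move: nn1; rewrite neq_ltn => /orP[h|h]; [rewrite orbC|]; apply: He.
  move=> /orP[]; first by apply: active => //; rewrite eq_sym.
  by move=> en; case: nact; apply: (active n1 n).
have [fk fkc fkE] := @coord_functional R p p1 k.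
have [|_ [n ->] []] :=
    weakly_dense_meets fkc gc (@open_normc_gt R rho) (@open_normc_lt R d) xd.
  exists ((2 * rho)%:C%C *: lp_basis p1 k).
  rewrite fkE functional_scale gk lp_scale basis_diag /mkset mulr0 normc0 mulr1.
  by rewrite normc_real//; [split => //|]; lra.
rewrite fkE /mkset => zk gz; have := Hg n (Hrho n zk).
by rewrite leNgt gz.
Qed.

End WeakToNorm.

Theorem theorem1p6 (R : realType) (p : R) (p1 : 1 <= p)
    (w : int -> R[i]) (T : {linear lp p1 -> lp p1})
    (T_shift : is_bilateral_shift w T) :
  (p < 2 -> weakly_hypercyclic T -> hypercyclic T) /\
  (p <= 2 -> weakly_supercyclic T -> supercyclic T).
Proof.
split=> [plt2|p2]; last exact: (@weakly_supercyclic_supercyclic R p p1 p2 w T T_shift).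
exact: (@weakly_hypercyclic_hypercyclic R p p1 (ltW plt2) w T T_shift plt2).
Qed.
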